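(* Assume $R_0$ is trace class. Define the pathwise total dissipation $$\Sigma(\omega):=\sum_{n=1}^{\tau(\omega)-1}D_n(\omega),$$ where the sum is understood as the limit of its increasing partial sums in the trace norm. Then: (1) For $\nu_{\mathrm{tr}}$-almost every $\omega$, the series defining $\Sigma(\omega)$ converges in trace norm to an element of $S_1(H)_+$, and $\Sigma(\omega)=R_0-R_\infty(\omega)$ in $S_1(H)$. (2) The set function $$\mathsf{M}(E):=\sum_{n=1}^\infty\int_ED_n(\omega)\,d\nu_{\mathrm{tr}}(\omega),\qquad E\subset\Omega\text{ Borel},$$ is well-defined as an $S_1(H)_+$-valued, countably additive measure. Moreover, $\mathsf{M}\ll\nu_{\mathrm{tr}}$ and $\mathsf{M}(E)=\int_E\Sigma(\omega)\,d\nu_{\mathrm{tr}}(\omega)$ for all Borel $E\subset\Omega$. (3) The total mass satisfies $$\mathsf{M}(\Omega)=R_0-\int_\Omega R_\infty(\omega)\,d\nu_{\mathrm{tr}}(\omega),$$ and, in particular, $\mathrm{tr}(\mathsf{M}(\Omega))=\mathrm{tr}(R_0)-\int_\Omega\mathrm{tr}(R_\infty(\omega))\,d\nu_{\mathrm{tr}}(\omega)$. (4) If, in addition, there exists $\alpha\in(0,m]$ such that $s^{(\mathrm{tr})}_w\ge\alpha\,\mathrm{tr}(R_w)$ for every finite word $w\in\{1,\dots,m\}^*$, then $\Sigma(\omega)=R_0$ for $\nu_{\mathrm{tr}}$-almost every $\omega$, hence $\mathsf{M}(E)=\nu_{\mathrm{tr}}(E)R_0$ for all Borel $E\subset\Om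ega$.
   Context: $H$ is a complex Hilbert space and $B(H)_+$ is the set of bounded positive operators on $H$; $S_1(H)$ is the trace class with norm $\|\cdot\|_1$, $S_1(H)_+:=S_1(H)\cap B(H)_+$. Integrals of $S_1(H)$-valued functions are Bochner integrals. Fix $m\ge1$, $R_0\in B(H)_+$ and contractions $C_1,\dots,C_m\in B(H)$. For finite words $w$ over $\{1,\dots,m\}$ (including the empty word $\emptyset$) define $R_\emptyset:=R_0$, $R_{wj}:=R_w^{1/2}(I-C_j^*C_j)R_w^{1/2}$, and $D_{w,j}:=R_w-R_{wj}=R_w^{1/2}C_j^*C_jR_w^{1/2}$. Path space: $\mathcal{A}:=\{0,1,\dots,m\}$, $\Omega:=\mathcal{A}^{\mathbb{N}}$ with the product topology and Borel $\sigma$-algebra; for a finite word $u$ over $\mathcal{A}$, $[u]$ is the cylinder of sequences with prefix $u$. If a finite word $u$ over $\mathcal{A}$ contains a $0$, set $R_u:=R_v$ with $v$ the prefix of $u$ before its first $0$. For a finite word $u$ and $a\in\mathcal{A}$, $D_{u,a}:=R_u^{1/2}C_a^*C_aR_u^{1/2}$ if $a\neq0$ and $u$ contains no $0$, and $D_{u,a}:=0$ otherwise. For $\omega\in\Omega$ let $\omega|n=\omega_1\cdots\omega_n$ ($\omega|0=\emptyset$), $R_n(\omega):=R_{\omega|n}$ ($n\ge0$), $D_n(\omega):=D_{\omega|n-1,\,\omega_n}$ ($n\ge1$), $\tau(\omega):=\inf\{n\ge1:\omega_n=0\}\in\{1,2,\dots\}\cup\{\infty\}$ (if $\tau(\omega)=\infty$,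 sums up to $\tau(\omega)-1$ run over all indices $\ge1$). The sequence $R_n(\omega)$ is decreasing and $R_\infty(\omega)\in B(H)_+$ denotes its strong operator limit. Trace-biased measure $\nu_{\mathrm{tr}}$ (for $R_0$ trace class, in which case all $R_w$, $D_{w,j}$ are trace class): for $w\in\{1,\dots,m\}^*$ let $e^{(\mathrm{tr})}_{w,j}:=\mathrm{tr}(D_{w,j})$ and $s^{(\mathrm{tr})}_w:=\sum_{j=1}^me^{(\mathrm{tr})}_{w,j}$. If $s^{(\mathrm{tr})}_w>0$ put $p^{(\mathrm{tr})}_{w,0}:=0$, $p^{(\mathrm{tr})}_{w,j}:=e^{(\mathrm{tr})}_{w,j}/s^{(\mathrm{tr})}_w$ for $1\le j\le m$; if $s^{(\mathrm{tr})}_w=0$ put $p^{(\mathrm{tr})}_{w,0}:=1$, $p^{(\mathrm{tr})}_{w,j}:=0$ for $1\le j\le m$. If a finite word $u$ contains $0$, put $p^{(\mathrm{tr})}_{u,0}:=1$, $p^{(\mathrm{tr})}_{u,j}:=0$ for $1\le j\le m$. Then $\nu_{\mathrm{tr}}$ is the unique Borel probability measure on $\Omega$ with $\nu_{\mathrm{tr}}([\emptyset])=1$ and $\nu_{\mathrm{tr}}([ua])=\nu_{\mathrm{tr}}([u])\,p^{(\mathrm{tr})}_{u,a}$ for all finite words $u$ over $\mathcal{A}$ and $a\in\mathcal{A}$ (Kolmogorov extension). *)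

(* Defs.v *)
From HB Require Import structures.
From mathcomp Require Import all_boot all_order all_algebra.
From mathcomp Require Import all_classical all_reals all_analysis.
From mathcomp Require Import complex.

Set Implicit Arguments.
Unset Strict Implicit.
Unset Printing Implicit Defensive.

Import Order.TTheory GRing.Theory Num.Theory.
Import numFieldNormedType.Exports.

Local Open Scope classical_set_scope.
Local Open Scope ring_scope.
Local Open Scope complex_scope.

HB.mixin Record CompleteNormedModule_isHilbert (R : realType) H
    & CompleteNormedModule R[i] H := {
  inner : H -> H -> R[i] ;
  inner_linearl : forall (a : R[i]) (x y z : H),
    inner (a *: x + y) z = a * inner x z + inner y z ;
  inner_conj : forall x y : H, inner y x = (inner x y)^* ;
  inner_norm : forall x : H, inner x x = `|x| ^+ 2
}.

#[short(type="hilbertType")]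
HB.structure Definition Hilbert (R : realType) :=
  {H of CompleteNormedModule R[i] H & CompleteNormedModule_isHilbert R H}.

(* Operators are plain functions H -> H (which form an R[i]-module for the
   pointwise operations) satisfying bounded_op.  Objects that exist uniquely
   (adjoints, square roots, limits, integrals) are selected with xget. *)
Section Operators.
Context {R : realType} {H : hilbertType R}.
Implicit Types (A S T L : H -> H) (u : nat -> H -> H).

Definition bounded_op T :=
  (forall (a : R[i]) (x y : H), T (a *: x + y) = a *: T x + T y) /\
  exists M : R[i], forall x, `|T x| <= M * `|x|.

Definition contraction_op T := bounded_op T /\ forall x, `|T x| <= `|x|.

(* In R[i], 0 <= z means that z is real and nonnegative. *)
Definition posop T := bounded_op T /\ forall x, 0 <= inner (T x) x.

Definition adj T : H -> H :=
  xget 0 [set S | bounded_op S /\ forall x y, inner (T x) y = inner x (S y)].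

Definition sqrtop A : H -> H := xget 0 [set S | posop S /\ S \o S = A].

Definition absop T : H -> H := sqrtop (adj T \o T).

Definition orthonormal_basis (B : set H) :=
  [/\ forall e, B e -> inner e e = 1,
      forall e f, B e -> B f -> e != f -> inner e f = 0 &
      forall x, (forall e, B e -> inner x e = 0) -> x = 0].

Definition onb : set H := xget set0 [set B | orthonormal_basis B].

(* The [0, +oo]-valued trace; it is only applied to positive operators. *)
Definition optrace A : \bar R :=
  (\esum_(e in onb) (complex.Re (inner (A e) e))%:E)%E.

Definition trnorm T : \bar R := optrace (absop T).

Definition trace_class T := bounded_op T /\ (trnorm T < +oo)%E.

Definition trace_class_pos T := trace_class T /\ posop T.

Definition tr_cvg u L :=
  [/\ forall n, trace_class (u n), trace_class L &
      trnorm (u n - L) @[n --> \oo] --> (0 : \bar R)%E].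

Definition tr_lim u : H -> H := xget 0 [set L | tr_cvg u L].

Definition strong_lim u : H -> H :=
  xget 0 [set L | bounded_op L /\ forall x, u n x @[n --> \oo] --> L x].

End Operators.

Section Bochner.
Context {R : realType} {H : hilbertType R}.
Context {d : measure_display} {T : measurableType d} (P : probability T R).
Implicit Types (E : set T) (f s : T -> H -> H).

Definition simple_op s :=
  [/\ finite_set (range s), forall v, measurable (s @^-1` [set v]) &
      forall t, trace_class (s t)].

Definition simple_integral E s : H -> H :=
  \sum_(v \in range s) (fine (P (E `&` s @^-1` [set v])))%:C *: v.

Definition strongly_measurable E f :=
  exists s : nat -> T -> H -> H, (forall n, simple_op (s n)) /\
    {ae P, forall t, E t -> tr_cvg (fun n => s n t) (f t)}.

Definition is_bochner E f (I : H -> H) :=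
  strongly_measurable E f /\
  exists s : nat -> T -> H -> H,
    [/\ forall n, simple_op (s n),
        (\int[P]_(t in E) trnorm (s n t - f t)%R)%E @[n --> \oo] -->
          (0 : \bar R)%E &
        tr_cvg (fun n => simple_integral E (s n)) I].

Definition bochner_integrable E f := exists I, is_bochner E f I.

Definition bochner E f : H -> H := xget 0 [set I | is_bochner E f I].

End Bochner.

(* Words over {1, ..., m} have type seq 'I_m and words over {0, ..., m} have
   type seq 'I_m.+1; the letter j : 'I_m corresponds to lift ord0 j. *)
Definition nonzero_prefix m (u : seq 'I_m.+1) : seq 'I_m :=
  pmap (unlift ord0) (take (index ord0 u) u).

Definition path_space (m : nat) : Type :=
  prod_topology (fun _ : nat => discrete_topology 'I_m.+1).

HB.instance Definition _ m := Topological.on (path_space m).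
HB.instance Definition _ m :=
  isPointed.Build (path_space m) (fun=> ord0 : 'I_m.+1).

Definition borel_path (m : nat) := g_sigma_algebraType (@open (path_space m)).

Section Paths.
Context {m : nat}.

(* The n-th letter (n >= 1) of a path; paths are stored from index 0. *)
Definition letter (w : path_space m) (n : nat) : 'I_m.+1 := w n.-1.

Definition path_prefix (w : path_space m) (n : nat) : seq 'I_m.+1 :=
  [seq letter w k | k <- iota 1 n].

Definition cylinder (u : seq 'I_m.+1) : set (borel_path m) :=
  [set w | path_prefix w (size u) = u].

Definition tau {R : realType} (w : path_space m) : \bar R :=
  ereal_inf [set n%:R%:E | n in [set n | (1 <= n)%N /\ letter w n = ord0]].

End Paths.

Section Dissipation.
Context {R : realType} {H : hilbertType R} {m : nat}.
Variables (C : 'I_m -> H -> H) (R0 : H -> H).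

Definition R_step (A : H -> H) (j : 'I_m) : H -> H :=
  sqrtop A \o (idfun - (adj (C j) \o C j)) \o sqrtop A.

Definition R_word (w : seq 'I_m) : H -> H := foldl R_step R0 w.

Definition D_word (w : seq 'I_m) (j : 'I_m) : H -> H :=
  R_word w - R_word (rcons w j).

Definition R_path (u : seq 'I_m.+1) : H -> H := R_word (nonzero_prefix u).

Definition D_path (u : seq 'I_m.+1) (a : 'I_m.+1) : H -> H :=
  if ord0 \in u then 0
  else if unlift ord0 a is Some j
       then sqrtop (R_path u) \o adj (C j) \o C j \o sqrtop (R_path u)
       else 0.

Definition R_ (n : nat) (w : path_space m) : H -> H :=
  R_path (path_prefix w n).

(* Meaningful for n >= 1 only. *)
Definition D_ (n : nat) (w : path_space m) : H -> H :=
  D_path (path_prefix w n.-1) (letter w n).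

Definition R_infty (w : path_space m) : H -> H :=
  strong_lim (fun n => R_ n w).

Definition e_tr (w : seq 'I_m) (j : 'I_m) : R := fine (optrace (D_word w j)).

Definition s_tr (w : seq 'I_m) : R := \sum_(j < m) e_tr w j.

Definition p_tr (u : seq 'I_m.+1) (a : 'I_m.+1) : R :=
  let w := nonzero_prefix u in
  if (ord0 \notin u) && (0 < s_tr w)
  then if unlift ord0 a is Some j then e_tr w j / s_tr w else 0
  else (a == ord0)%:R.

Definition is_nu_tr (nu : probability (borel_path m) R) :=
  nu (cylinder [::]) = 1%E /\
  forall u a, (nu (cylinder (rcons u a)) = nu (cylinder u) * (p_tr u a)%:E)%E.

Definition Sigma_partial (w : path_space m) (N : nat) : H -> H :=
  \sum_(1 <= n < N.+1 | (n%:R%:E < tau w :> \bar R)%E) D_ n w.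

Definition Sigma (w : path_space m) : H -> H := tr_lim (Sigma_partial w).

Definition M_partial (nu : probability (borel_path m) R)
    (E : set (borel_path m)) (N : nat) : H -> H :=
  \sum_(1 <= n < N.+1) bochner nu E (D_ n).

Definition M_ (nu : probability (borel_path m) R) (E : set (borel_path m)) :
    H -> H :=
  tr_lim (M_partial nu E).

End Dissipation.

(* Main.v *)
(* Write D_n = R_(n-1) - R_n, so that the partial sums of Sigma telescope to
   R_0 - R_n.  The operators R_n decrease, hence converge strongly, and a decreasing
   sequence of positive trace class operators converges in trace norm, because on
   positive operators the trace norm is the additive functional tr.  Each R_n takes
   finitely many values, so its Bochner integral is a finite sum; these integrals
   decrease in n as well, and their limit is the integral of R_infty.  Only
   differences of comparable operators occur, so the triangle inequality for the
   trace norm is never needed.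

   An operator is determined by the real functionals T |-> Re <T x, y>, which are
   bounded by the trace norm for x, y in the unit ball.  Testing against them makes
   Bochner integrals unique and reduces their additivity to that of scalar
   integrals.

   For the last part, Cauchy-Schwarz gives
     sum_j p_j tr(R_wj) = tr(R_w) - (sum_j e_j^2) / s <= tr(R_w) - s / m,
   so the expectation of tr(R_n) decays like (1 - alpha / m)^n and R_infty = 0
   almost surely. *)
Require Import Defs.
From mathcomp Require Import all_boot all_order all_algebra.
From mathcomp Require Import all_classical all_reals all_analysis.
From mathcomp Require Import finmap measurable_realfun complex ring lra.

Set Implicit Arguments.
Unset Strict Implicit.
Unset Printing Implicit Defensive.

Import Order.TTheory GRing.Theory Num.Theory.
Import numFieldNormedType.Exports.

Local Open Scope classical_set_scope.
Local Open Scope ring_scope.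
Local Open Scope complex_scope.

(** * The real inner product *)

(** The operator theory rests on three facts. (a) If 0 <= T <= M, Cauchy-Schwarz for the form <T x,
    y> gives |T x|^2 <= M <T x, x>. This turns convergence of the numbers <T_n x, x> into
    convergence of the vectors T_n x, and lets a trace bound an operator norm. (b) A positive
    operator has exactly one positive square root. Besides giving R_wj a meaning, this yields |T| =
    T for positive T, which is why the trace norm becomes a trace there. (c) The trace is a sum over
    one fixed orthonormal basis, handled only as an additive, monotone functional with <S x, x> <=
    tr(S) |x|^2; independence of the basis never comes up. Absolute continuity and countable
    additivity of M both come from the single bound M(E) <= nu(E) R_0. The decay estimate must also
    cover stopped paths: the letter 0 is drawn only if s_w <= 0, and then alpha tr(R_w) <= 0, so the
    trace has already vanished. *)

Lemma quadratic_ge0_discr (R : realFieldType) (a b c : R) : 0 <= c ->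
  (forall t, 0 <= a + t * b *+ 2 + t ^+ 2 * c) -> b ^+ 2 <= a * c.
Proof.
rewrite le_eqVlt => /predU1P[<-|c0] h; last first.
  have := h (- (b / c)); rewrite -(pmulr_lge0 _ c0).
  set e := (X in 0 <= X -> _); have -> : e = a * c - b ^+ 2.
    by rewrite /e; field; rewrite gt_eqF.
  by rewrite subr_ge0.
rewrite mulr0; have [->|b0] := eqVneq b 0; first by rewrite expr0n.
(* With c = 0 the expression is affine in t, and this t gives it the value -1. *)
have := h (- (a + 1) / (b *+ 2)).
set e := (X in 0 <= X -> _); have -> : e = -1.
  by rewrite /e; field; rewrite ?mulrn_eq0 ?b0.
by rewrite oppr_ge0 ler10.
Qed.

Section RealInner.
Context {R : realType} {H : hilbertType R}.
Implicit Types x y z : H.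

(** Keeping only the real part places all estimates in the ordered field R; [innerE] recovers the
    complex inner product from the pairings of x with y and with 'i *: y. *)
Definition ip x y : R := complex.Re (inner x y).
Definition nrm x : R := complex.Re `|x|.

Lemma ReM_real (a : R) (z : R[i]) : complex.Re (a%:C * z) = a * complex.Re z.
Proof. by case: z => u v /=; rewrite mul0r subr0. Qed.

Lemma inner1l x y z : inner (x + y) z = inner x z + inner y z.
Proof. by rewrite -[x]scale1r inner_linearl mul1r scale1r. Qed.

Lemma inner0l z : inner 0 z = 0.
Proof. by apply: (addrI (inner 0 z)); rewrite -inner1l !addr0. Qed.

Lemma innerZl (a : R[i]) x z : inner (a *: x) z = a * inner x z.
Proof. by rewrite -[a *: x]addr0 inner_linearl inner0l addr0. Qed.

Lemma innerZr (a : R[i]) x z : inner x (a *: z) = a^* * inner x z.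
Proof. by rewrite inner_conj innerZl rmorphM /= -inner_conj. Qed.

Lemma ipC x y : ip x y = ip y x.
Proof. by rewrite /ip inner_conj; case: (inner y x). Qed.

Lemma ipDl x y z : ip (x + y) z = ip x z + ip y z.
Proof. by rewrite /ip inner1l; case: (inner x z) => ? ?; case: (inner y z). Qed.

Lemma ipZl (a : R) x y : ip (a%:C *: x) y = a * ip x y.
Proof. by rewrite /ip innerZl ReM_real. Qed.

Lemma ipDr x y z : ip z (x + y) = ip z x + ip z y.
Proof. by rewrite ipC ipDl !(ipC z). Qed.

Lemma ipZr (a : R) x y : ip y (a%:C *: x) = a * ip y x.
Proof. by rewrite ipC ipZl ipC. Qed.

Lemma ip0l y : ip 0 y = 0. Proof. by rewrite /ip inner0l. Qed.
Lemma ip0r y : ip y 0 = 0. Proof. by rewrite ipC ip0l. Qed.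

Lemma ipNl x y : ip (- x) y = - ip x y.
Proof. by apply/eqP; rewrite -addr_eq0 -ipDl addNr ip0l. Qed.

Lemma ipNr x y : ip x (- y) = - ip x y.
Proof. by rewrite ipC ipNl ipC. Qed.

Lemma ipBl x y z : ip (x - y) z = ip x z - ip y z.
Proof. by rewrite ipDl ipNl. Qed.

Lemma ipBr x y z : ip z (x - y) = ip z x - ip z y.
Proof. by rewrite ipDr ipNr. Qed.

Lemma ip_suml (I : Type) (r : seq I) (P : pred I) (F : I -> H) y :
  ip (\sum_(i <- r | P i) F i) y = \sum_(i <- r | P i) ip (F i) y.
Proof. by apply: (big_morph (ip^~ y) (fun a b => ipDl a b y) (ip0l y)). Qed.

Lemma ipii x y : ip ('i *: x) ('i *: y) = ip x y.
Proof.
rewrite /ip innerZl innerZr; case: (inner x y) => a b /=; ring.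
Qed.

Lemma ip_iC x y : ip ('i *: x) y = - ip x ('i *: y).
Proof. by rewrite -(ipii x) scalerA -expr2 sqr_i scaleN1r ipNr opprK. Qed.

Lemma Im_inner x y : complex.Im (inner x y) = ip x ('i *: y).
Proof. rewrite /ip innerZr; case: (inner x y) => a b /=; ring. Qed.

Lemma innerE x y : inner x y = (ip x y +i* ip x ('i *: y))%C.
Proof. by rewrite -Im_inner /ip; case: (inner x y). Qed.

Lemma normE x : `|x| = (nrm x)%:C.
Proof. by rewrite /nrm RRe_real// realE normr_ge0. Qed.

Lemma nrm_ge0 x : 0 <= nrm x.
Proof. by rewrite -ler0c -normE normr_ge0. Qed.

Lemma nrm_sqr x : nrm x ^+ 2 = ip x x.
Proof. by rewrite /ip inner_norm normE -rmorphXn. Qed.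

Lemma ip_ge0 x : 0 <= ip x x.
Proof. by rewrite -nrm_sqr sqr_ge0. Qed.

Lemma nrm_eq0 x : nrm x = 0 -> x = 0.
Proof. by move=> h; apply/eqP; rewrite -normr_eq0 normE h. Qed.

Lemma ip_eq0 x : ip x x = 0 -> x = 0.
Proof. by move/eqP; rewrite -nrm_sqr sqrf_eq0 => /eqP/nrm_eq0. Qed.

Lemma nrm0 : nrm 0 = 0 :> R. Proof. by rewrite /nrm normr0. Qed.

Lemma ip_inj x y : (forall z, ip x z = ip y z) -> x = y.
Proof.
by move=> h; apply/eqP; rewrite -subr_eq0; apply/eqP/ip_eq0; rewrite ipBl h subrr.
Qed.

Lemma nrmB x y : nrm (x - y) = nrm (y - x). Proof. by rewrite /nrm distrC. Qed.

Lemma ler_nrmD x y : nrm (x + y) <= nrm x + nrm y.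
Proof. by rewrite -lecR rmorphD /= -!normE ler_normD. Qed.

Lemma nrmZ (a : R) x : nrm (a%:C *: x) = `|a| * nrm x.
Proof.
apply: complexI; rewrite -normE normrZ rmorphM /= -normE; congr (_ * _).
by rewrite normc_def /= expr0n /= addr0 sqrtr_sqr.
Qed.

Definition rlinear (T : H -> H) :=
  (forall x y, T (x + y) = T x + T y) /\
  (forall (a : R) x, T (a%:C *: x) = a%:C *: T x).

Lemma rlinear_id : rlinear idfun. Proof. by []. Qed.

(** The form is nonnegative at x + t y for every real t, and the discriminant of this quadratic in t
    is the claim. A general [P] serves both the inner product itself ([P] the identity) and the
    forms of positive operators. *)
Lemma form_cauchy_schwarz (P : H -> H) : rlinear P ->
  (forall x y, ip (P x) y = ip x (P y)) -> (forall x, 0 <= ip (P x) x) ->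
  forall x y, ip (P x) y ^+ 2 <= ip (P x) x * ip (P y) y.
Proof.
move=> [PD PZ] Psym Ppos x y; apply: quadratic_ge0_discr => // t.
have := Ppos (x + t%:C *: y); rewrite PD PZ !ipDl !ipDr !ipZl !ipZr.
by rewrite (Psym y x) (ipC y); congr (0 <= _); ring.
Qed.

Lemma cauchy_schwarz x y : `|ip x y| <= nrm x * nrm y.
Proof.
rewrite -ler_sqr ?nnegrE ?mulr_ge0 ?nrm_ge0// exprMn !nrm_sqr real_normK ?num_real//.
exact: (form_cauchy_schwarz rlinear_id (fun _ _ => erefl) ip_ge0).
Qed.

Lemma cvg_nrmP (u : nat -> H) (l : H) :
  u n @[n --> \oo] --> l <-> nrm (u n - l) @[n --> \oo] --> (0 : R).
Proof.
split=> [/cvgrPdist_lt ul|/cvgrPdist_lt ul].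
  apply/cvgrPdist_lt => e e0; have /ul : 0 < e%:C by rewrite ltcR.
  apply: filterS => n; rewrite sub0r normrN ger0_norm ?nrm_ge0//.
  by rewrite distrC normE ltcR.
apply/cvgrPdist_lt => e e0.
(* The norm of H takes values in R[i], where a positive radius is automatically real. *)
have ei : e = (complex.Re e)%:C by rewrite RRe_real// realE ltW.
have /ul : 0 < complex.Re e by rewrite -ltcR -ei.
apply: filterS => n; rewrite sub0r normrN ger0_norm ?nrm_ge0//.
by rewrite distrC normE ei ltcR.
Qed.

Lemma nrm_complete (u : nat -> H) :
  (forall e : R, 0 < e -> exists N, forall n m, (N <= n)%N -> (N <= m)%N ->
     nrm (u n - u m) < e) -> exists l : H, u n @[n --> \oo] --> l.
Proof.
move=> h; apply/cvg_ex/cauchy_cvgP/cauchy_ballP => e e0; near_simpl.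
have ei : e = (complex.Re e)%:C by rewrite RRe_real// realE ltW.
have /h[N hN] : 0 < complex.Re e by rewrite -ltcR -ei.
exists ([set n | (N <= n)%N], [set n | (N <= n)%N]); first by split; exists N.
move=> [n m] [/= Nn Nm]; rewrite -ball_normE /= normE ei ltcR; exact: hN.
Qed.

Lemma cvgH_unique (u : nat -> H) (l : H) l' :
  u n @[n --> \oo] --> l -> u n @[n --> \oo] --> l' -> l = l'.
Proof. exact: norm_cvg_unique. Qed.

Lemma nrm_le_ip (x : H) (a : R) : 0 <= a -> ip x x <= a ^+ 2 -> nrm x <= a.
Proof. by move=> a0; rewrite -nrm_sqr ler_sqr ?nnegrE ?nrm_ge0. Qed.

Lemma cvg_ipl (u : nat -> H) (l : H) y : u n @[n --> \oo] --> l ->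
  ip (u n) y @[n --> \oo] --> ip l y.
Proof.
move=> /cvg_nrmP ul; apply/subr_cvg0.
apply: (@squeeze_cvgr _ _ _ _ (fun n => - (nrm (u n - l) * nrm y))
  (fun n => nrm (u n - l) * nrm y)).
- by apply: nearW => n /=; rewrite -ipBl -ler_norml cauchy_schwarz.
- by rewrite -oppr0 -(mul0r (nrm y)); apply: cvgN; apply: cvgM => //; exact: cvg_cst.
- by rewrite -(mul0r (nrm y)); apply: cvgM => //; exact: cvg_cst.
Qed.

Lemma cvg_ip2 (u v : nat -> H) (l k : H) : u n @[n --> \oo] --> l ->
  v n @[n --> \oo] --> k -> ip (u n) (v n) @[n --> \oo] --> ip l k.
Proof.
move=> ul vk.
have -> : (fun n => ip (u n) (v n)) =
  (fun n => (ip (u n) k + ip l (v n - k)) + ip (u n - l) (v n - k)).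
  by apply/funext => n; rewrite !ipBl !ipBr; ring.
rewrite -[ip l k]addr0 -[ip l k]addr0; apply: cvgD; first apply: cvgD.
- exact: cvg_ipl.
- rewrite -(ip0l l); under eq_fun do rewrite ipC; apply: cvg_ipl.
  by rewrite -(subrr k); apply: cvgB => //; exact: cvg_cst.
move/cvg_nrmP in ul; move/cvg_nrmP in vk.
apply: (@squeeze_cvgr _ _ _ _ (fun n => - (nrm (u n - l) * nrm (v n - k)))
  (fun n => nrm (u n - l) * nrm (v n - k))).
- by apply: nearW => n /=; rewrite -ler_norml cauchy_schwarz.
- by rewrite -oppr0 -(mul0r 0); apply: cvgN; exact: cvgM.
- by rewrite -(mul0r 0); exact: cvgM.
Qed.

Lemma cvg_harmonicM (a : R) : a * n.+1%:R^-1 @[n --> \oo] --> (0 : R).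
Proof. by rewrite -(mulr0 a); apply: cvgM; [exact: cvg_cst|exact: cvg_harmonic]. Qed.

Lemma quad_ge0_linear0 (b c : R) :
  (forall t, 0 <= t * b *+ 2 + t ^+ 2 * c) -> b = 0.
Proof.
move=> h; have c0 : 0 <= c.
  by have := h 1; have := h (-1); rewrite sqrrN expr1n !mul1r mulN1r; lra.
have : b ^+ 2 <= 0 * c by apply: quadratic_ge0_discr => // t; rewrite add0r.
by rewrite mul0r => ?; apply/eqP; rewrite -sqrf_eq0 eq_le sqr_ge0 andbT.
Qed.

(* The vector z minimizes J(v) = |v|^2 - 2 g(v) over the closure of V; the
   parallelogram law makes minimizing sequences Cauchy. *)
Lemma subspace_representer (V : set H) (g : H -> R) (M : R) :
  V 0 -> (forall x y, V x -> V y -> V (x + y)) ->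
  (forall (a : R) x, V x -> V (a%:C *: x)) ->
  (forall x y, g (x + y) = g x + g y) ->
  (forall (a : R) x, g (a%:C *: x) = a * g x) ->
  (forall x, g x <= M * nrm x) ->
  exists z : H, (exists2 v : nat -> H, (forall n, V (v n)) & v n @[n --> \oo] --> z) /\
    forall h, V h -> ip z h = g h.
Proof.
move=> V0 VD VZ gD gZ gM.
pose J v := ip v v - g v *+ 2; pose d := inf (J @` V).
have hinf : has_inf (J @` V).
  split; first by exists (J 0), 0.
  (* Completing the square: J(v) >= |v|^2 - 2 M |v| >= - M^2. *)
  exists (- M ^+ 2) => _ [v Vv <-]; rewrite /J -nrm_sqr.
  have := gM v; have := sqr_ge0 (nrm v - M); rewrite sqrrB.
  by move: (nrm v ^+ 2) (M * nrm v) (mulrC M (nrm v)) => p q <-; lra.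
have dJ v : V v -> d <= J v.
  by move=> Vv; apply: ge_inf; [case: hinf|exists v].
have /choice[v /all_and2[Vv Jv]] n : exists v, V v /\ J v < d + n.+1%:R^-1.
  have n0 : 0 < n.+1%:R^-1 :> R by rewrite invr_gt0.
  have [_ [v Vv <-] ?] := inf_adherent n0 hinf.
  by exists v.
(* Obtained by comparing J with its infimum d at the midpoint of a and b. *)
have par a b : V a -> V b ->
    ip (a - b) (a - b) <= (J a - d) *+ 2 + (J b - d) *+ 2.
  move=> Va Vb; have := dJ _ (VZ 2^-1 _ (VD _ _ Va Vb)).
  rewrite /J gZ gD !(ipBl, ipBr) ipZl ipZr !(ipDl, ipDr) (ipC b a).
  by move: (ip a a) (ip b b) (ip a b) (g a) (g b) => *; lra.
have [z vz] : exists z : H, v n @[n --> \oo] --> z.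
  apply: nrm_complete => e e0.
  have [N hN] : exists N, forall n, (N <= n)%N -> n.+1%:R^-1 * 4 < e ^+ 2.
    have /cvgrPdist_lt/(_ (e ^+ 2)) := cvg_harmonicM 4.
    rewrite exprn_gt0// => /(_ isT)[N _ hN]; exists N => n /hN /=.
    rewrite sub0r normrN ger0_norm ?mulr_ge0 ?invr_ge0//; by rewrite mulrC.
  exists N => n k Nn Nk; rewrite -ltr_sqr ?nnegrE ?nrm_ge0 ?(ltW e0)// nrm_sqr.
  rewrite (le_lt_trans (par _ _ (Vv n) (Vv k)))//.
  have := hN _ Nn; have := hN _ Nk; have := Jv n; have := Jv k.
  move: (J (v n)) (J (v k)) (n.+1%:R^-1) (k.+1%:R^-1) (e ^+ 2) => *; lra.
exists z; split; first by exists v.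
move=> h Vh; apply/eqP; rewrite -subr_eq0; apply/eqP.
apply: (@quad_ge0_linear0 _ (ip h h)) => t.
(* J(v n + t h) >= d > J(v n) - 1/(n+1) makes this expression nonnegative; in the limit a quadratic
   in t without constant term is nonnegative, so its linear coefficient vanishes. *)
have lim : t * (ip (v n) h - g h) *+ 2 + t ^+ 2 * ip h h + n.+1%:R^-1
    @[n --> \oo] --> t * (ip z h - g h) *+ 2 + t ^+ 2 * ip h h.
  rewrite -[X in _ --> X]addr0; apply: cvgD; last exact: cvg_harmonic.
  apply: cvgD; last exact: cvg_cst.
  apply: cvgMn; apply: cvgM; first exact: cvg_cst.
  apply: cvgB; last exact: cvg_cst.
  exact: cvg_ipl.
apply: (cvgr_to_ge lim); apply: nearW => n.
have := dJ _ (VD _ _ (Vv n) (VZ t _ Vh)); have := Jv n.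
rewrite /J gD gZ !(ipDl, ipDr) !ipZl !ipZr (ipC h).
move: (ip (v n) (v n)) (g (v n)) (ip (v n) h) (g h) (ip h h) (_^-1).
by move=> a b c e f i h1 h2; nra.
Qed.

End RealInner.

(** * Bounded and positive operators *)

Section Operators.
Context {R : realType} {H : hilbertType R}.
Implicit Types (x y z : H) (A B S T L X : H -> H).

Lemma opDE S T x : (S + T) x = S x + T x. Proof. by []. Qed.
Lemma opNE T x : (- T) x = - T x. Proof. by []. Qed.
Lemma opZE (a : R[i]) T x : (a *: T) x = a *: T x. Proof. by []. Qed.
Definition opE := (opDE, opNE, opZE).

Lemma ipZcl (a : R[i]) x y : ip (a *: x) y = ip x (a^* *: y).
Proof. by rewrite /ip innerZl innerZr conjCK. Qed.

Lemma bopP T : bounded_op T <->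
  (forall (a : R[i]) x y, T (a *: x + y) = a *: T x + T y) /\
  exists2 M : R, 0 <= M & forall x, nrm (T x) <= M * nrm x.
Proof.
split=> -[Tlin [M]].
  move=> MT; split=> //; exists (Num.max 0 (complex.Re M)); first by rewrite le_max lexx.
  move=> x; have := MT x; rewrite !normE lecE mulrC ReM_real => /andP[_ /= h].
  by rewrite (le_trans h)// mulrC ler_wpM2r ?nrm_ge0// le_max lexx orbT.
by move=> M0 MT; split=> //; exists M%:C => x; rewrite !normE -rmorphM lecR.
Qed.

Section Linearity.
Variables (T : H -> H) (bT : bounded_op T).

Lemma bopD x y : T (x + y) = T x + T y.
Proof. by have [h _] := bT; have := h 1 x y; rewrite !scale1r. Qed.

Lemma bop0 : T 0 = 0.
Proof. by apply: (addrI (T 0)); rewrite -bopD !addr0. Qed.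

Lemma bopZ (a : R[i]) x : T (a *: x) = a *: T x.
Proof. by have [h _] := bT; have := h a x 0; rewrite !addr0 bop0 addr0. Qed.

Lemma bopN x : T (- x) = - T x.
Proof. by rewrite -scaleN1r bopZ scaleN1r. Qed.

Lemma bopB x y : T (x - y) = T x - T y.
Proof. by rewrite bopD bopN. Qed.

Lemma bop_rlinear : rlinear T.
Proof. by split=> *; rewrite ?bopD ?bopZ. Qed.

Lemma bop_bound : exists2 M : R, 0 <= M & forall x, nrm (T x) <= M * nrm x.
Proof. by have /bopP[] := bT. Qed.

Lemma bop_continuous (u : nat -> H) (l : H) :
  u n @[n --> \oo] --> l -> T (u n) @[n --> \oo] --> T l.
Proof.
have [M M0 TM] := bop_bound.
move=> /cvg_nrmP ul; apply/cvg_nrmP.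
apply: (@squeeze_cvgr _ _ _ _ (fun=> 0) (fun n => M * nrm (u n - l))).
- by apply: nearW => n; rewrite nrm_ge0 -bopB TM.
- exact: cvg_cst.
- by rewrite -(mulr0 M); apply: cvgM => //; exact: cvg_cst.
Qed.

End Linearity.

Lemma bop_id : bounded_op (idfun : H -> H).
Proof. by split=> //; exists 1 => x; rewrite mul1r. Qed.

Lemma bop_zero : bounded_op (0 : H -> H).
Proof.
by split=> [a x y|]; [rewrite /= scaler0 addr0|exists 0 => x; rewrite normr0 mul0r].
Qed.

Lemma bop_add S T : bounded_op S -> bounded_op T -> bounded_op (S + T).
Proof.
move=> bS bT; have [M M0 SM] := bop_bound bS; have [K K0 TK] := bop_bound bT.
apply/bopP; split=> [a x y|].
  by rewrite !opE (bopD bS) (bopD bT) (bopZ bS) (bopZ bT) scalerDr addrACA.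
exists (M + K) => [|x]; first exact: addr_ge0.
by rewrite mulrDl (le_trans (ler_nrmD _ _))// lerD.
Qed.

Lemma bop_scale (a : R[i]) T : bounded_op T -> bounded_op (a *: T).
Proof.
move=> bT; have [lT [M TM]] := bT; split=> [b x y|].
  by rewrite !opE lT scalerDr !scalerA mulrC.
exists (`|a| * M) => x; rewrite !opE normrZ -mulrA ler_wpM2l//.
Qed.

Lemma bop_opp T : bounded_op T -> bounded_op (- T).
Proof. by rewrite -scaleN1r; exact: bop_scale. Qed.

Lemma bop_sub S T : bounded_op S -> bounded_op T -> bounded_op (S - T).
Proof. by move=> bS bT; apply: bop_add => //; exact: bop_opp. Qed.

Lemma bop_comp S T : bounded_op S -> bounded_op T -> bounded_op (S \o T).
Proof.
move=> bS bT; have [M M0 SM] := bop_bound bS; have [K K0 TK] := bop_bound bT.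
apply/bopP; split=> [a x y|]; first by rewrite /= (bopD bT) (bopZ bT) (bopD bS) (bopZ bS).
exists (M * K) => [|x]; first exact: mulr_ge0.
by rewrite (le_trans (SM _))// -mulrA ler_wpM2l//.
Qed.

(* Over the complex numbers positivity implies symmetry, by polarization. *)
Lemma posopP T : posop T <-> [/\ bounded_op T,
  (forall x y, ip (T x) y = ip x (T y)) & forall x, 0 <= ip (T x) x].
Proof.
split=> [[bT pT]|[bT sT pT]].
  have T0 x : ip (T x) ('i *: x) = 0.
    by rewrite -Im_inner; apply: ger0_Im; exact: pT.
  split=> // [x y|x]; last by have := pT x; rewrite lecE => /andP[].
  have := T0 (x - 'i *: y).
  rewrite scalerBr scalerA -expr2 sqr_i scaleN1r opprK (bopB bT) (bopZ bT).
  rewrite !(ipBl, ipDr) ipii ip_iC !T0 add0r oppr0 addr0 (ipC (T y)) => /eqP.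
  by rewrite subr_eq0 => /eqP.
split=> // x; rewrite innerE lecE /= pT andbT.
have h : ip (T x) ('i *: x) = - ip (T x) ('i *: x).
  by rewrite -ip_iC -(bopZ bT) sT ipC.
by apply/eqP; move: h; set u := ip _ _ => h; lra.
Qed.

Lemma posop_bop T : posop T -> bounded_op T. Proof. by case. Qed.

Lemma posop_sym T : posop T -> forall x y, ip (T x) y = ip x (T y).
Proof. by case/posopP. Qed.

Lemma posop_ge0 T : posop T -> forall x, 0 <= ip (T x) x.
Proof. by case/posopP. Qed.

Lemma posop0 : posop (0 : H -> H).
Proof.
apply/posopP; split; first exact: bop_zero.
- by move=> x y; rewrite ip0l ip0r.
- by move=> x; rewrite ip0l.
Qed.

Lemma posop_id : posop (idfun : H -> H).
Proof. by apply/posopP; split=> //; [exact: bop_id|exact: ip_ge0]. Qed.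

Lemma posop_add S T : posop S -> posop T -> posop (S + T).
Proof.
move=> /posopP[bS sS pS] /posopP[bT sT pT]; apply/posopP; split.
- exact: bop_add.
- by move=> x y; rewrite !opE ipDl ipDr sS sT.
- by move=> x; rewrite !opE ipDl addr_ge0.
Qed.

Lemma posop_scale (a : R) T : 0 <= a -> posop T -> posop (a%:C *: T).
Proof.
move=> a0 /posopP[bT sT pT]; apply/posopP; split.
- exact: bop_scale.
- by move=> x y; rewrite !opE ipZl ipZr sT.
- by move=> x; rewrite !opE ipZl mulr_ge0.
Qed.

Lemma posop_sum (I : Type) (r : seq I) (P : pred I) (F : I -> H -> H) :
  (forall i, P i -> posop (F i)) -> posop (\sum_(i <- r | P i) F i).
Proof. move=> h; elim/big_ind : _ => //; [exact: posop0|exact: posop_add]. Qed.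

Lemma posop_conj B B' T : bounded_op B -> bounded_op B' ->
  (forall x y, ip (B x) y = ip x (B' y)) -> posop T -> posop (B' \o T \o B).
Proof.
move=> bB bB' BB' /posopP[bT sT pT]; apply/posopP; split.
- by apply: bop_comp => //; exact: bop_comp.
- by move=> x y; rewrite /= ipC -!BB' ipC sT.
- by move=> x; rewrite /= ipC -BB' ipC.
Qed.

Lemma posop_sqr T : posop T -> posop (T \o T).
Proof.
move=> pT; have := posop_conj (posop_bop pT) (posop_bop pT) (posop_sym pT) posop_id.
by [].
Qed.

Lemma posop_ub T : posop T -> exists2 M : R, 0 < M & forall x, ip (T x) x <= M * ip x x.
Proof.
move=> pT; have [M M0 TM] := bop_bound (posop_bop pT).
exists (M + 1) => [|x]; first by rewrite ltr_wpDl.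
rewrite (le_trans (ler_norm _))// (le_trans (cauchy_schwarz _ _))//.
rewrite -nrm_sqr expr2 mulrA ler_wpM2r ?nrm_ge0// (le_trans (TM _))//.
by rewrite ler_wpM2r ?nrm_ge0// lerDl.
Qed.

(** Cauchy-Schwarz for the form of T at the pair x, T x gives |T x|^4 <= <T x, x> <T T x, T x> <= <T
    x, x> M |T x|^2, and |T x|^2 cancels. *)
Lemma posop_sqr_le T (M : R) : posop T -> (forall x, ip (T x) x <= M * ip x x) ->
  forall x, ip (T x) (T x) <= M * ip (T x) x.
Proof.
move=> pT TM x; have := form_cauchy_schwarz (bop_rlinear (posop_bop pT))
  (posop_sym pT) (posop_ge0 pT) x (T x).
have [->|a0] := eqVneq (ip (T x) (T x)) 0.
  move=> _.
  (* A negative [M] leaves only the vector 0. *)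
  have [h|h] := leP 0 M; first by rewrite mulr_ge0// posop_ge0.
  have x0 : x = 0.
    apply: ip_eq0; apply/eqP; rewrite eq_le ip_ge0 andbT -(nmulr_rge0 _ h).
    exact: le_trans (posop_ge0 pT x) (TM x).
  by rewrite x0 ip0r mulr0.
move=> CS; have a1 : 0 < ip (T x) (T x) by rewrite lt_neqAle eq_sym a0 ip_ge0.
rewrite -(ler_pM2r a1) -expr2 (le_trans CS)//.
by rewrite (le_trans (ler_wpM2l (posop_ge0 pT x) (TM _)))// mulrCA mulrA.
Qed.

Lemma posop_eq0 T x : posop T -> ip (T x) x = 0 -> T x = 0.
Proof.
move=> pT h; have [M _ TM] := posop_ub pT; apply: ip_eq0; apply/eqP.
by rewrite eq_le ip_ge0 andbT (le_trans (posop_sqr_le pT TM x))// h mulr0.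
Qed.

Lemma posop_lim (T : nat -> H -> H) L : (forall n, posop (T n)) -> bounded_op L ->
  (forall x, T n x @[n --> \oo] --> L x) -> posop L.
Proof.
move=> pT bL TL; apply/posopP; split=> // [x y|x].
  apply: (@cvg_unique _ (@norm_hausdorff _ R) (ip (T n x) y @[n --> \oo])).
    exact: cvg_ipl.
  have -> : (fun n => ip (T n x) y) = (fun n => ip (T n y) x).
    by apply/funext => n; rewrite (posop_sym (pT n)) ipC.
  by rewrite ipC; exact: cvg_ipl.
apply: (cvgr_to_ge (cvg_ipl (TL x))).
by apply: nearW => n; exact: posop_ge0.
Qed.

(** * Monotone sequences of positive operators *)

Lemma posop_decr (T : nat -> H -> H) : (forall n, posop (T n - T n.+1)) ->
  forall n k, posop (T n - T (n + k)%N).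
Proof.
move=> dT n; elim=> [|k ih]; first by rewrite addn0 subrr; exact: posop0.
have -> : T n - T (n + k.+1)%N = (T n - T (n + k)%N) + (T (n + k)%N - T (n + k).+1).
  by rewrite addrA subrK addnS.
exact: posop_add.
Qed.

Lemma cvg_addn_shift (u : nat -> H) (l : H) n :
  u k @[k --> \oo] --> l -> u (n + k)%N @[k --> \oo] --> l.
Proof.
have -> : (fun k => u (n + k)%N) = (fun k => u (k + n)%N).
  by apply/funext => k; rewrite addnC.
by rewrite cvg_shiftn.
Qed.

(** The real sequence <T n x, x> decreases and is bounded below. Applying [posop_sqr_le] to T n - T
    (n + k), which lies below M, bounds |T n x - T (n + k) x|^2 by M times its increments, so T n x
    is Cauchy. *)
Theorem decreasing_posop_cvg (T : nat -> H -> H) :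
  (forall n, posop (T n)) -> (forall n, posop (T n - T n.+1)) ->
  exists L, [/\ posop L, (forall x, T n x @[n --> \oo] --> L x) &
    forall n, posop (T n - L)].
Proof.
move=> pT dT; have [M M0 TM] := posop_ub (pT 0).
have dT' := posop_decr dT.
have mono n k x : ip (T (n + k)%N x) x <= ip (T n x) x.
  by rewrite -subr_ge0 -ipBl; exact: (posop_ge0 (dT' n k)).
have TnM n x : ip (T n x) x <= M * ip x x.
  exact: le_trans (mono 0 n x) (TM x).
have sq n k x : ip (T n x - T (n + k)%N x) (T n x - T (n + k)%N x) <=
    M * (ip (T n x) x - ip (T (n + k)%N x) x).
  rewrite -ipBl; apply: (posop_sqr_le (dT' n k)) => y.
  rewrite opE ipBl (le_trans _ (TnM n y))// gerBl; exact: posop_ge0.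
have /choice[L TL] : forall x, exists l : H, T n x @[n --> \oo] --> l.
  move=> x; apply: nrm_complete => e e0.
  have cv : cvgn (fun n => ip (T n x) x).
    apply: nonincreasing_is_cvgn; last first.
      by exists 0 => _ [n _ <-]; exact: posop_ge0.
    by apply/nonincreasing_seqP => n; rewrite -[n.+1]addn1.
  (* The factor M in [sq] turns this bound into (e / 2)^2; each of the two indices is then compared
     with N. *)
  have [N hN] : exists N, forall k, ip (T N x) x - ip (T (N + k)%N x) x < (e / 2) ^+ 2 / M.
    have e1 : 0 < (e / 2) ^+ 2 / M / 2 by rewrite !divr_gt0// exprn_gt0// divr_gt0.
    move/cvgrPdist_lt : cv => /(_ _ e1)[N _ hN]; exists N => k.
    have := hN N (leqnn _); have := hN (N + k)%N (leq_addr _ _).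
    rewrite /= !ltr_norml; move: (lim _) => l; lra.
  exists N => n m /subnKC <- /subnKC <-.
  have half k : nrm (T N x - T (N + k)%N x) < e / 2.
    have e2 : 0 <= e / 2 by rewrite divr_ge0// ltW.
    rewrite -ltr_sqr ?nnegrE ?nrm_ge0// nrm_sqr (le_lt_trans (sq _ _ _))//.
    by rewrite mulrC -ltr_pdivlMr.
  have -> : T (N + (n - N))%N x - T (N + (m - N))%N x =
    (T (N + (n - N))%N x - T N x) + (T N x - T (N + (m - N))%N x).
    by rewrite addrA subrK.
  rewrite (le_lt_trans (ler_nrmD _ _))// (splitr e) ltrD// nrmB.
  exact: half.
have bL : bounded_op L.
  apply/bopP; split=> [a x y|].
    apply: (cvgH_unique (TL (a *: x + y))).
    under eq_fun do rewrite (bopD (posop_bop (pT _))) (bopZ (posop_bop (pT _))).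
    by apply: cvgD => //; exact: cvgZl_tmp.
  exists M => [|x]; first exact: ltW.
  apply: nrm_le_ip; first by rewrite mulr_ge0 ?nrm_ge0// ltW.
  rewrite exprMn nrm_sqr; apply: (cvgr_to_le (cvg_ip2 (TL x) (TL x))).
  apply: nearW => n; rewrite (le_trans (posop_sqr_le (pT n) (TnM n) x))//.
  by rewrite expr2 -mulrA ler_wpM2l// ltW.
exists L; split=> // [|n]; first exact: posop_lim TL.
apply: (@posop_lim (fun k => T n - T (n + k)%N)) => // [|x].
  by apply: bop_sub => //; exact: posop_bop.
rewrite opE; apply: cvgB; first exact: cvg_cst.
exact: (cvg_addn_shift n (TL x)).
Qed.

Corollary increasing_posop_cvg (T : nat -> H -> H) B : posop B ->
  (forall n, posop (T n.+1 - T n)) -> (forall n, posop (B - T n)) ->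
  exists L, [/\ bounded_op L, (forall x, T n x @[n --> \oo] --> L x) &
    forall n, posop (L - T n)].
Proof.
move=> pB dT uT.
have [|L [pL TL LT]] := @decreasing_posop_cvg (fun n => B - T n) uT.
  move=> n; suff -> : B - T n - (B - T n.+1) = T n.+1 - T n by [].
  by rewrite opprB addrC addrA subrK.
exists (B - L); split=> [|x|n].
- by apply: bop_sub; exact: posop_bop.
- have -> : (fun n => T n x) = (fun n => B x - (B - T n) x).
    by apply/funext => n; rewrite opE subKr.
  by apply: cvgB => //; exact: cvg_cst.
- by have := LT n; rewrite addrAC.
Qed.

(** Riesz representation: [subspace_representer] on the whole space represents x -> Re <T x, y> by a
    vector, which is taken as S y. *)
Lemma bop_adjoint_exists T : bounded_op T ->
  exists S, bounded_op S /\ forall x y, ip (T x) y = ip x (S y).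
Proof.
move=> bT; have [M M0 TM] := bop_bound bT.
have /choice[S TS] y : exists z, forall x, ip (T x) y = ip x z.
  have [||x|z [_ hz]] := @subspace_representer R H setT (fun x => ip (T x) y) (M * nrm y)
      I (fun _ _ _ _ => I) (fun _ _ _ => I).
  - by move=> u v; rewrite /= (bopD bT) ipDl.
  - by move=> a u; rewrite /= (bopZ bT) ipZl.
  - rewrite (le_trans (ler_norm _))// (le_trans (cauchy_schwarz _ _))//.
    by rewrite mulrAC ler_wpM2r ?nrm_ge0.
  - by exists z => x; rewrite -(hz x I) ipC.
exists S; split=> //; apply/bopP; split=> [a x y|].
  apply: ip_inj => z.
  (* The representer comes from a real argument; complex homogeneity of S is inherited from T by
     moving the conjugate scalar across. *)
  have az : ip (T z) (a *: x) = ip z (a *: S x).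
    by rewrite -(conjCK a) -!ipZcl -(bopZ bT) TS.
  by rewrite ipC -TS ipDr az TS -ipDr ipC.
exists M => // y; have [->|y0] := eqVneq (nrm (S y)) 0.
  by rewrite mulr_ge0 ?nrm_ge0.
have y1 : 0 < nrm (S y) by rewrite lt_neqAle eq_sym y0 nrm_ge0.
rewrite -(ler_pM2r y1) -expr2 nrm_sqr -TS (le_trans (ler_norm _))//.
by rewrite (le_trans (cauchy_schwarz _ _))// mulrAC ler_wpM2r ?nrm_ge0.
Qed.

Lemma inner_adjE T S : bounded_op T -> bounded_op S ->
  (forall x y, inner (T x) y = inner x (S y)) <->
  (forall x y, ip (T x) y = ip x (S y)).
Proof.
move=> bT bS; split=> h x y; first by rewrite /ip h.
by rewrite !innerE !h (bopZ bS).
Qed.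

Lemma adjP T : bounded_op T ->
  bounded_op (adj T) /\ forall x y, ip (T x) y = ip x (adj T y).
Proof.
move=> bT; have [S [bS TS]] := bop_adjoint_exists bT.
have := @xgetPex _ 0 [set S | bounded_op S /\ forall x y, inner (T x) y = inner x (S y)].
case; first by exists S; split=> //; exact/inner_adjE.
by move=> bA hA; split=> //; exact/inner_adjE.
Qed.

Lemma adj_unique T S : bounded_op T -> (forall x y, ip (T x) y = ip x (S y)) ->
  adj T = S.
Proof.
move=> bT TS; have [bA hA] := adjP bT; apply/funext => y; apply: ip_inj => z.
by rewrite !(ipC _ z) -hA -TS.
Qed.

Lemma posop_adj_comp T : bounded_op T -> posop (adj T \o T).
Proof.
by move=> bT; have [bA hA] := adjP bT; have := posop_conj bT bA hA posop_id.
Qed.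

(* The nonnegative combinations of powers of X: all of them are positive when X
   is, although products of positive operators in general are not. *)
Inductive power_cone X : (H -> H) -> Prop :=
| power_cone0 : power_cone X 0
| power_coneD c n T : 0 <= c -> power_cone X T ->
    power_cone X ((c%:C : R[i]) *: (fun x => iter n X x) + T).

Lemma power_cone_add X S T : power_cone X S -> power_cone X T -> power_cone X (S + T).
Proof.
by move=> cS cT; elim: cS => [|c n S' c0 _ ih]; rewrite ?add0r// -addrA; constructor.
Qed.

Lemma power_cone_scale X (c : R) T : 0 <= c -> power_cone X T ->
  power_cone X ((c%:C : R[i]) *: T).
Proof.
move=> c0; elim=> [|a n S a0 _ ih]; first by rewrite scaler0; constructor.
by rewrite scalerDr scalerA -rmorphM; constructor => //; exact: mulr_ge0.
Qed.

Section Cone.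
Variables (X : H -> H) (pX : posop X).
Let bX := posop_bop pX.

Lemma power_coneX T : power_cone X T -> power_cone X (X \o T).
Proof.
elim=> [|a n S a0 _ ih].
  have -> : X \o (0 : H -> H) = (0 : H -> H) by apply/funext => x; exact: (bop0 bX).
  by constructor.
have -> : X \o ((a%:C : R[i]) *: (fun x => iter n X x) + S) =
  ((a%:C : R[i]) *: (fun x => iter n.+1 X x) + (X \o S)).
  by apply/funext => x; rewrite /= !opE (bopD bX) (bopZ bX).
by constructor.
Qed.

Lemma power_cone_iter n T : power_cone X T -> power_cone X (fun x => iter n X (T x)).
Proof. by move=> cT; elim: n => //= n /power_coneX. Qed.

Lemma power_cone_comp S T : power_cone X S -> power_cone X T -> power_cone X (S \o T).
Proof.
move=> cS cT; elim: cS => [|a n S' a0 _ ih]; first by constructor.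
have -> : ((a%:C : R[i]) *: (fun x => iter n X x) + S') \o T =
  ((a%:C : R[i]) *: (fun x => iter n X (T x)) + (S' \o T)) by [].
by apply: power_cone_add => //; apply: power_cone_scale => //; exact: power_cone_iter.
Qed.

(** X^(n+2) is the conjugate X X^n X of a positive operator, so the induction carries two
    consecutive exponents. *)
Lemma posop_iter n : posop (fun x => iter n X x).
Proof.
suff: posop (fun x => iter n X x) /\ posop (fun x => iter n.+1 X x) by case.
elim: n => [|n [ih1 ih2]]; first by split=> //; exact: posop_id.
split=> //; have := posop_conj bX bX (posop_sym pX) ih1.
by congr posop; apply/funext => x; rewrite /= -iterSr.
Qed.

Lemma power_cone_posop T : power_cone X T -> posop T.
Proof.
elim=> [|a n S a0 _ ih]; first exact: posop0.
by apply: posop_add => //; apply: posop_scale => //; exact: posop_iter.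
Qed.

End Cone.

End Operators.

(** * Square roots of positive operators *)

Section SquareRoot.
Context {R : realType} {H : hilbertType R}.
Implicit Types (x y z : H) (A B S T L X : H -> H).

(* (S - T) S (S - T) + (S - T) T (S - T) = (S^2 - T^2) (S - T) = 0, so both of
   these positive summands vanish. *)
Lemma sqrt_unique S T : posop S -> posop T -> S \o S = T \o T ->
  S \o T = T \o S -> S = T.
Proof.
move=> pS pT eST cST; have bS := posop_bop pS; have bT := posop_bop pT.
apply/funext => x; apply/eqP; rewrite -subr_eq0; apply/eqP.
have SSx y : S (S y) = T (T y) by have := congr1 (@^~ y) eST.
have STx y : S (T y) = T (S y) by have := congr1 (@^~ y) cST.
pose y := S x - T x.
have sum0 : ip (S y) y + ip (T y) y = 0.
  rewrite -ipDl /y (bopB bS) (bopB bT) SSx STx -[RHS](ip0l y); congr ip.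
  by rewrite addrA subrK subrr.
have Sy : S y = 0.
  apply: (posop_eq0 pS); apply/eqP; rewrite eq_le posop_ge0// andbT.
  by rewrite -sum0 lerDl posop_ge0.
have Ty : T y = 0.
  apply: (posop_eq0 pT); apply/eqP; rewrite eq_le posop_ge0// andbT.
  by rewrite -sum0 lerDr posop_ge0.
apply: ip_eq0; rewrite -/y {1}/y ipBl (posop_sym pS) (posop_sym pT).
by rewrite Sy Ty ip0r subrr.
Qed.

(* With X = 1 - A, the iteration Y' = (X + Y^2) / 2 increases to a solution of
   Y = (X + Y^2) / 2, that is (1 - Y)^2 = A. *)
Lemma sqrt_exists_le1 A : posop A -> posop (idfun - A) ->
  exists S, [/\ posop S, S \o S = A &
    forall T, bounded_op T -> T \o A = A \o T -> T \o S = S \o T].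
Proof.
move=> pA pX; set X := idfun - A.
have bA := posop_bop pA; have bX := posop_bop pX.
pose h : R[i] := (2^-1 : R)%:C.
have h2 : h + h = 1.
  by rewrite /h -rmorphD /=; have -> : 2^-1 + 2^-1 = 1 :> R by lra.
pose Y n := iter n (fun Z : H -> H => h *: (X + (Z \o Z))) (0 : H -> H).
have YS n : Y n.+1 = h *: (X + (Y n \o Y n)) by [].
have h0 : 0 <= 2^-1 :> R by [].
have cX : power_cone X X.
  by have := power_coneD 1 ler01 (power_cone0 X); rewrite scale1r addr0.
have cY n : power_cone X (Y n).
  elim: n => [|n ih]; first exact: power_cone0.
  rewrite YS; apply: power_cone_scale => //; apply: power_cone_add => //.
  exact: power_cone_comp.
have bY n := posop_bop (power_cone_posop pX (cY n)).
(* The increment of Y^2 is written as Y' (Y' - Y) + (Y' - Y) Y, a sum of products inside the cone,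
   without commuting any factors. *)
have cD n : power_cone X (Y n.+1 - Y n).
  elim: n => [|n ih].
    by rewrite subr0; exact: cY.
  have -> : Y n.+2 - Y n.+1 =
      h *: ((Y n.+1 \o (Y n.+1 - Y n)) + ((Y n.+1 - Y n) \o Y n)).
    rewrite (YS n.+1) [X in _ - X = _](YS n) -scalerBr; congr (_ *: _); apply/funext => x.
    rewrite -[LHS]/(X x + Y n.+1 (Y n.+1 x) - (X x + Y n (Y n x))).
    rewrite -[RHS]/(Y n.+1 (Y n.+1 x - Y n x) + (Y n.+1 (Y n x) - Y n (Y n x))).
    rewrite (bopB (bY n.+1)).
    by rewrite opprD addrACA subrr add0r addrA subrK.
  apply: power_cone_scale => //; apply: power_cone_add; exact: power_cone_comp.
(* If Y <= 1 then |Y x|^2 <= <Y x, x> <= |x|^2 and X <= 1, so the average of X and Y^2 stays below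
   1. *)
have Yle n x : ip (Y n x) x <= ip x x.
  elim: n x => [|n ih] x; first by rewrite ip0l ip_ge0.
  rewrite YS !opE ipZl ipDl.
  have pYn := power_cone_posop pX (cY n).
  have h1 : ip (Y n x) (Y n x) <= ip (Y n x) x.
    have := @posop_sqr_le _ _ _ 1 pYn _ x; rewrite mul1r; apply => y.
    by rewrite mul1r.
  have Xle : ip (X x) x <= ip x x by rewrite /X opE ipBl gerBl posop_ge0.
  by move: h1 Xle (ih x); rewrite /= -(posop_sym pYn); lra.
have pB n : posop (idfun - Y n).
  have := power_cone_posop pX (cY n) => pYn.
  apply/posopP; split=> [|x y|x].
  - by apply: bop_sub => //; exact: bop_id.
  - by rewrite !opE ipBl ipBr (posop_sym pYn).
  - by rewrite opE ipBl subr_ge0.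
have [L [bL YL LY]] := increasing_posop_cvg posop_id (fun n => power_cone_posop pX (cD n)) pB.
(* Both the operator and its argument vary with n; the correction Y n (L x - Y n x) tends to 0
   because every Y n is a contraction. *)
have YnL x : Y n (Y n x) @[n --> \oo] --> L (L x).
  have -> : (fun n => Y n (Y n x)) = (fun n => Y n (L x) - Y n (L x - Y n x)).
    by apply/funext => n; rewrite (bopB (bY n)) subKr.
  rewrite -[L (L x)]subr0; apply: cvgB => //; apply/cvg_nrmP.
  have /cvg_nrmP lim := YL x.
  apply: (@squeeze_cvgr _ _ _ _ (fun=> 0) (fun n => nrm (Y n x - L x))) => //.
    apply: nearW => n; rewrite nrm_ge0 subr0 -[leRHS]nrmB /=.
    apply: nrm_le_ip; first exact: nrm_ge0.
    rewrite nrm_sqr (le_trans (posop_sqr_le (M := 1) (power_cone_posop pX (cY n)) _ _))//.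
      by move=> y; rewrite mul1r.
    by rewrite mul1r.
  exact: cvg_cst.
have LE x : L x = h *: (X x + L (L x)).
  apply: (cvgH_unique (u := fun n => Y n.+1 x)).
    by have := YL x; rewrite -(cvg_shiftS (fun n => Y n x)).
  apply: cvgZl_tmp; apply: cvgD; first exact: cvg_cst.
  exact: YnL.
exists (idfun - L); split.
- by apply: (posop_lim pB) => [|x]; [apply: bop_sub => //; exact: bop_id
    |apply: cvgB => //; exact: cvg_cst].
- apply/funext => x; rewrite /= !opE (bopB bL).
  have e2 : L x + L x = X x + L (L x).
    by rewrite {1 2}(LE x) -scalerDl h2 scale1r.
  have -> : L (L x) = L x + L x - X x by rewrite e2 addrAC subrr add0r.
  rewrite /X !opE /= opprB [L x + L x - _ - _]addrAC addrK addrA subrK.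
  by rewrite subKr.
(* T commutes with X = 1 - A, hence with every Y n, hence with the limit. *)
- move=> T bT TA.
  have TX x : T (X x) = X (T x).
    by rewrite /X !opE (bopB bT); congr (_ - _); exact: (congr1 (@^~ x) TA).
  have TY n x : T (Y n x) = Y n (T x).
    elim: n x => [|n ih] x; first exact: bop0.
    by rewrite YS !opE (bopZ bT) (bopD bT) TX /= !ih.
  apply/funext => x; rewrite /= !opE (bopB bT); congr (_ - _).
  apply: (cvgH_unique (u := fun n => T (Y n x))); first exact: bop_continuous.
  have -> : (fun n => T (Y n x)) = (fun n => Y n (T x)) by apply/funext.
  exact: YL.
Qed.

(** Dividing A by an upper bound M reduces to A <= 1. The commutation clause supplies the commuting
    hypothesis of [sqrt_unique]. *)
Theorem sqrt_exists A : posop A -> exists S, [/\ posop S, S \o S = A &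
  forall T, bounded_op T -> T \o A = A \o T -> T \o S = S \o T].
Proof.
move=> pA; have [M M0 AM] := posop_ub pA; have bA := posop_bop pA.
have Mi0 : 0 <= M^-1 by rewrite invr_ge0 ltW.
have [||S [pS SS cS]] := @sqrt_exists_le1 ((M^-1)%:C *: A).
- exact: posop_scale.
- apply/posopP; split=> [|x y|x].
  + by apply: bop_sub; [exact: bop_id|exact: bop_scale].
  + by rewrite !opE ipBl ipBr ipZl ipZr (posop_sym pA).
  + by rewrite !opE ipBl subr_ge0 ipZl mulrC ler_pdivrMr// mulrC.
exists ((Num.sqrt M)%:C *: S); split.
- by apply: posop_scale => //; exact: sqrtr_ge0.
- apply/funext => x; rewrite /= !opE (bopZ (posop_bop pS)) scalerA -rmorphM /=.
  rewrite -expr2 sqr_sqrtr ?ltW//; have /= -> := congr1 (@^~ x) SS.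
  by rewrite !opE scalerA -rmorphM /= divff ?scale1r// gt_eqF.
- move=> T bT TA; apply/funext => x; rewrite /= !opE (bopZ bT); congr (_ *: _).
  have := cS T bT; move=> /(_ _)/(congr1 (@^~ x)); apply.
  apply/funext => y; rewrite /= !opE (bopZ bT); congr (_ *: _).
  exact: (congr1 (@^~ y) TA).
Qed.

Lemma sqrtopP A : posop A -> posop (sqrtop A) /\ sqrtop A \o sqrtop A = A.
Proof.
move=> pA; have := @xgetPex _ 0 [set S | posop S /\ S \o S = A].
by apply; have [S [pS SS _]] := sqrt_exists pA; exists S.
Qed.

(** Any positive root T of A commutes with A = T T, hence with the constructed root B, so T = B by
    [sqrt_unique]; this covers both S and the root chosen by [sqrtop]. *)
Lemma sqrtop_unique A S : posop A -> posop S -> S \o S = A -> sqrtop A = S.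
Proof.
move=> pA pS SA; have [B [pB BA cB]] := sqrt_exists pA.
have uniq T : posop T -> T \o T = A -> T = B.
  move=> pT TA; apply: sqrt_unique => //; first by rewrite TA BA.
  by apply: cB; [exact: posop_bop|rewrite -TA].
by have [p1 p2] := sqrtopP pA; rewrite (uniq _ p1 p2) (uniq _ pS SA).
Qed.

Lemma absop_posop T : bounded_op T -> posop (absop T).
Proof. by move=> bT; have [] := sqrtopP (posop_adj_comp bT). Qed.

Lemma absop_nrm T x : bounded_op T -> ip (absop T x) (absop T x) = ip (T x) (T x).
Proof.
move=> bT; have [p1 p2] := sqrtopP (posop_adj_comp bT); have [_ h] := adjP bT.
rewrite -/(absop T) in p1 p2.
by rewrite (posop_sym p1) h; have /= -> := congr1 (@^~ x) p2.
Qed.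

Lemma absop_pos T : posop T -> absop T = T.
Proof.
move=> pT; have bT := posop_bop pT.
rewrite /absop (adj_unique bT (posop_sym pT)).
by apply: sqrtop_unique => //; exact: posop_sqr.
Qed.

Lemma adj_opp T : bounded_op T -> adj (- T) = - adj T.
Proof.
move=> bT; apply: adj_unique; first exact: bop_opp.
by move=> x y; rewrite !opE ipNl ipNr; have [_ ->] := adjP bT.
Qed.

Lemma absop_opp T : bounded_op T -> absop (- T) = absop T.
Proof.
move=> bT; rewrite /absop adj_opp//; congr sqrtop; apply/funext => x.
have [bA _] := adjP bT.
by rewrite /= !opE (bopN bA) opprK.
Qed.

End SquareRoot.

(** * Trace and trace norm *)

Lemma sum_cauchy_schwarz (R : realFieldType) (I : Type) (F : seq I) (a b : I -> R) :
  (\sum_(e <- F) a e * b e) ^+ 2 <=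
  (\sum_(e <- F) a e ^+ 2) * (\sum_(e <- F) b e ^+ 2).
Proof.
apply: quadratic_ge0_discr => [|t]; first by apply: sumr_ge0 => e _; exact: sqr_ge0.
have -> : \sum_(e <- F) a e ^+ 2 + t * (\sum_(e <- F) a e * b e) *+ 2 +
    t ^+ 2 * (\sum_(e <- F) b e ^+ 2) = \sum_(e <- F) (a e + t * b e) ^+ 2.
  rewrite -mulrnAr -sumrMnl !big_distrr /= -!big_split /=; apply: eq_bigr => e _; ring.
by apply: sumr_ge0 => e _; exact: sqr_ge0.
Qed.

Section Trace.
Context {R : realType} {H : hilbertType R}.
Implicit Types (x y z e : H) (A B S T L : H -> H) (F G : {fset H}).

Definition orthonormal (B : set H) :=
  (forall e, B e -> inner e e = 1) /\
  (forall e f, B e -> B f -> e != f -> inner e f = 0).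

Lemma orthonormal_basis_exists : exists B : set H, orthonormal_basis B.
Proof.
have [C CF totC|B [[B1 B0] Bmax]] := @Zorn_bigcup H orthonormal.
  split=> [e [X CX Xe]|e f [X CX Xe] [Y CY Yf]].
    by have [h _] := CF _ CX; exact: h.
  have [XY|YX] := totC _ _ CX CY.
    by have [_ h] := CF _ CY; apply: h => //; exact: XY.
  by have [_ h] := CF _ CX; apply: h => //; exact: YX.
exists B; split=> // x xB; apply: contrapT => /eqP x0.
(* A nonzero x orthogonal to the maximal set B would enlarge B after normalization. *)
have n0 : `|x| != 0 by rewrite normr_eq0.
pose u := `|x|^-1 *: x.
have uu : inner u u = 1.
  rewrite /u innerZl innerZr inner_norm expr2 geC0_conj ?invr_ge0//.
  by rewrite mulKf// mulVf.
have uB e : B e -> inner u e = 0 by move=> /xB xe; rewrite /u innerZl xe mulr0.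
have Bu e : B e -> inner e u = 0.
  by move=> Be; rewrite inner_conj uB// conjc0.
apply: (Bmax (B `|` [set u])).
  split; first by move=> ?; left.
  move=> /(_ u (or_intror erefl)) /uB; rewrite uu => /eqP; by rewrite oner_eq0.
split=> [e [/B1//|->//]|e f [Be|->] [Bf|->]].
- exact: B0.
- by move=> _; exact: Bu.
- by move=> _; exact: uB.
- by rewrite eqxx.
Qed.

Lemma onbP : orthonormal_basis (onb : set H).
Proof.
have := @xgetPex _ set0 [set B | @orthonormal_basis R H B].
by apply; exact: orthonormal_basis_exists.
Qed.

Definition cabs (c : R[i]) : R := complex.Re `|c|.

Lemma cabsE (c : R[i]) : `|c| = (cabs c)%:C.
Proof. by rewrite /cabs RRe_real// realE normr_ge0. Qed.

Lemma cabs_sqr (c : R[i]) : cabs c ^+ 2 = complex.Re (c * conjc c).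
Proof.
apply: complexI; rewrite rmorphXn /= -cabsE sqr_normc RRe_real// realE.
by rewrite mulcJ_ge0.
Qed.

Lemma nrmZc (c : R[i]) x : nrm (c *: x) = cabs c * nrm x.
Proof. by apply: complexI; rewrite -normE normrZ cabsE normE rmorphM. Qed.

Lemma inner_suml (F : {fset H}) (u : H -> H) y :
  inner (\sum_(e <- F) u e) y = \sum_(e <- F) inner (u e) y.
Proof.
by apply: (big_morph (fun x => inner x y) (fun a b => inner1l a b y) (inner0l y)).
Qed.

Lemma nrm_sum (F : {fset H}) (u : H -> H) :
  nrm (\sum_(e <- F) u e) <= \sum_(e <- F) nrm (u e).
Proof.
elim/big_rec2 : _ => [|e a b _ h]; first by rewrite nrm0.
by rewrite (le_trans (ler_nrmD _ _))// lerD2l.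
Qed.

(** The linear span of the basis, encoded by a vector's own Fourier expansion so that no
    coefficients have to be carried; [onb_span_widen] lets two expansions share an index set. *)
Definition onb_span : set H := [set v | exists F : {fset H}, [set` F] `<=` (onb : set H) /\
  v = \sum_(e <- F) inner v e *: e].

Lemma onb_span_widen F G v : [set` F] `<=` (onb : set H) -> [set` G] `<=` (onb : set H) ->
  {subset F <= G} -> v = \sum_(e <- F) inner v e *: e ->
  v = \sum_(e <- G) inner v e *: e.
Proof.
move=> FB GB /fsubsetP FG vF; rewrite {1}vF; apply: big_fset_incl => // e eG eF.
have [_ B0 _] := onbP.
suff -> : inner v e = 0 by rewrite scale0r.
rewrite vF inner_suml big1_seq// => f /andP[_ fF].
have fe : f != e by apply: contraNneq eF => <-.
by rewrite innerZl (B0 f e (FB _ fF) (GB _ eG) fe) mulr0.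
Qed.

Lemma onb_spanD v w : onb_span v -> onb_span w -> onb_span (v + w).
Proof.
move=> [F [FB vF]] [G [GB wG]]; exists (F `|` G)%fset.
have FGB : [set` (F `|` G)%fset] `<=` (onb : set H).
  by move=> e /=; rewrite in_fsetU => /orP[/FB|/GB].
split=> //; under eq_bigr do rewrite inner1l scalerDl.
rewrite big_split /=; congr (_ + _).
  by apply: (onb_span_widen FB FGB _ vF) => e eF; rewrite in_fsetU eF.
by apply: (onb_span_widen GB FGB _ wG) => e eG; rewrite in_fsetU eG orbT.
Qed.

Lemma onb_spanZ (c : R[i]) v : onb_span v -> onb_span (c *: v).
Proof.
move=> [F [FB vF]]; exists F; split=> //.
under eq_bigr do rewrite innerZl -scalerA.
by rewrite -scaler_sumr -vF.
Qed.

Lemma onb_span0 : onb_span 0.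
Proof. by exists fset0; split=> [e|]; rewrite ?big_seq_fset0// /= inE. Qed.

Lemma onb_span_onb e : onb e -> onb_span e.
Proof.
move=> Be; exists [fset e]%fset; split=> [f /=|]; first by rewrite inE => /eqP ->.
by have [B1 _ _] := onbP; rewrite big_seq_fset1 B1// scale1r.
Qed.

(** The representer z of Re <x, .> on the span lies in its closure, and z - x is orthogonal to every
    basis vector, so z = x. *)
Lemma onb_span_dense x :
  exists2 v : nat -> H, (forall n, onb_span (v n)) & v n @[n --> \oo] --> x.
Proof.
have [z [[v Vv vz] hz]] := @subspace_representer R H onb_span (ip x) (nrm x)
  onb_span0 onb_spanD (fun a => @onb_spanZ a%:C) (fun _ _ => ipDr _ _ _)
  (fun _ _ => ipZr _ _ _)
  (fun y => le_trans (ler_norm _) (cauchy_schwarz x y)).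
suff <- : z = x by exists v.
apply/eqP; rewrite -subr_eq0; apply/eqP.
have [_ _] := onbP; apply=> e Be.
(* The imaginary part of the inner product needs 'i *: e in the span as well. *)
by rewrite innerE !ipBl !hz ?subrr//; [apply: onb_spanZ|]; exact: onb_span_onb.
Qed.

Lemma onb_span_ip F v : v = \sum_(e <- F) inner v e *: e ->
  ip v v = \sum_(e <- F) cabs (inner v e) ^+ 2.
Proof.
move=> vF; rewrite {1}vF ip_suml; apply: eq_bigr => e _.
by rewrite /ip innerZl (inner_conj v e) cabs_sqr.
Qed.

Lemma optrace_ge_fset F S : [set` F] `<=` (onb : set H) ->
  ((\sum_(e <- F) ip (S e) e)%:E <= optrace S)%E.
Proof.
move=> FB; apply: esum_ge; exists [set` F]; first by split.
by rewrite fsbig_finite//= set_fsetK sumEFin.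
Qed.

Lemma optrace_le_fset S (t : \bar R) :
  (forall F, [set` F] `<=` (onb : set H) -> ((\sum_(e <- F) ip (S e) e)%:E <= t)%E) ->
  (optrace S <= t)%E.
Proof.
move=> h; apply: ge_ereal_sup => _ [X [finX XB] <-].
rewrite fsbig_finite//= sumEFin; apply: h => e /=.
by rewrite in_fset_set// => /set_mem/XB.
Qed.

Lemma optrace_adherent S (e : R) : 0 < e -> optrace S \is a fin_num ->
  exists2 F : {fset H}, [set` F] `<=` (onb : set H) & fine (optrace S) - e < \sum_(e <- F) ip (S e) e.
Proof.
move=> e0 fS; have [_ [X [finX XB] <-]] := ub_ereal_sup_adherent e0 fS.
rewrite fsbig_finite//= sumEFin => h; exists (fset_set X).
  by move=> f /=; rewrite in_fset_set// => /set_mem/XB.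
by rewrite -lte_fin EFinB fineK.
Qed.

Lemma optrace_ge0 S : posop S -> (0 <= optrace S)%E.
Proof. by move=> pS; apply: esum_ge0 => e _; rewrite lee_fin posop_ge0. Qed.

Lemma optrace_fin S : posop S -> (optrace S < +oo)%E -> optrace S \is a fin_num.
Proof. by move=> pS; rewrite ge0_fin_numE// optrace_ge0. Qed.

Lemma optraceD S T : posop S -> posop T ->
  optrace (S + T) = (optrace S + optrace T)%E.
Proof.
move=> pS pT; rewrite /optrace -esumD => [|e _|e _].
- by apply: eq_esum => e _; rewrite -EFinD -[in RHS]/(ip (S e) e + ip (T e) e) -ipDl.
- by rewrite lee_fin posop_ge0.
- by rewrite lee_fin posop_ge0.
Qed.

Lemma optrace0 : optrace (0 : H -> H) = 0%E.
Proof. by apply: esum1 => e _; rewrite -[complex.Re _]/(ip 0 e) ip0l. Qed.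

Lemma le_optrace S T : posop (T - S) -> (optrace S <= optrace T)%E.
Proof.
move=> pTS; apply: le_esum => e _; rewrite lee_fin -subr_ge0.
by have := posop_ge0 pTS e; rewrite opE ipBl.
Qed.

Lemma optraceZ (c : R) S : 0 <= c -> posop S ->
  optrace (c%:C *: S) = (c%:E * optrace S)%E.
Proof.
move=> c0 pS.
(* The reverse inequality is this one for c^-1 and the operator c S. *)
have le a T : 0 <= a -> (optrace ((a%:C : R[i]) *: T) <= a%:E * optrace T)%E.
  move=> a0; apply: optrace_le_fset => F FB.
  under eq_bigr do rewrite opE ipZl; rewrite -big_distrr /= EFinM.
  by rewrite lee_wpmul2l// optrace_ge_fset.
have [->|cn0] := eqVneq c 0; first by rewrite scale0r optrace0 mul0e.
apply/eqP; rewrite eq_le le//=.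
have := le c^-1 (c%:C *: S); rewrite invr_ge0 => /(_ c0).
rewrite scalerA -rmorphM /= mulVf// scale1r => h.
rewrite (le_trans (lee_wpmul2l _ h))// muleA -EFinM divff// mul1e//.
Qed.

Lemma optrace_sum (I : Type) (r : seq I) (P : pred I) (F : I -> H -> H) :
  (forall i, P i -> posop (F i)) ->
  optrace (\sum_(i <- r | P i) F i) = (\sum_(i <- r | P i) optrace (F i))%E.
Proof.
move=> pF.
suff [] : posop (\sum_(i <- r | P i) F i) /\
  optrace (\sum_(i <- r | P i) F i) = (\sum_(i <- r | P i) optrace (F i))%E by [].
elim/big_rec2 : _ => [|i a S Pi [pS <-]]; first by rewrite optrace0; split=> //; exact: posop0.
by split; [apply: posop_add => //; exact: pF|rewrite optraceD//; exact: pF].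
Qed.

(** Let B be the root of S. For w in the span, |B w| <= sum |w_e| |B e|, and Cauchy-Schwarz bounds
    its square by |w|^2 times the sum of |B e|^2 = <S e, e>, which is at most tr(S). Density does
    the rest. *)
Lemma posop_trace_bound S x : posop S -> (optrace S < +oo)%E ->
  ip (S x) x <= fine (optrace S) * ip x x.
Proof.
move=> pS fS; have [v Vv vx] := onb_span_dense x.
have [pB BS] := sqrtopP pS; set B := sqrtop S in pB BS.
have bound n : ip (S (v n)) (v n) <= fine (optrace S) * ip (v n) (v n).
  have [F [FB vF]] := Vv n; move: (v n) vF => w wF.
  have -> : ip (S w) w = nrm (B w) ^+ 2 by rewrite nrm_sqr (posop_sym pB) ipC -BS.
  have Bw : B w = \sum_(e <- F) inner w e *: B e.
    rewrite {1}wF (big_morph B (bopD (posop_bop pB)) (bop0 (posop_bop pB))).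
    by apply: eq_bigr => e _; rewrite (bopZ (posop_bop pB)).
  have h : nrm (B w) <= \sum_(e <- F) cabs (inner w e) * nrm (B e).
    by rewrite Bw (le_trans (nrm_sum _ _))//; under eq_bigr do rewrite nrmZc.
  rewrite (le_trans (ler_pM _ _ h h)) ?nrm_ge0// -expr2.
  rewrite (le_trans (sum_cauchy_schwarz _ _ _))// -onb_span_ip// mulrC.
  rewrite ler_wpM2r ?ip_ge0// -lee_fin fineK ?optrace_fin//.
  rewrite (le_trans _ (optrace_ge_fset S FB))// lee_fin ler_sum// => e _.
  by rewrite nrm_sqr (posop_sym pB) ipC -BS.
have lim : fine (optrace S) * ip (v n) (v n) - ip (S (v n)) (v n) @[n --> \oo]
    --> fine (optrace S) * ip x x - ip (S x) x.
  apply: cvgB.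
    by apply: cvgM; [exact: cvg_cst|exact: cvg_ip2].
  by apply: cvg_ip2 => //; apply: bop_continuous => //; exact: posop_bop.
rewrite -subr_ge0; apply: (cvgr_to_ge lim).
by apply: nearW => n; rewrite subr_ge0.
Qed.

(** * Trace norm and convergence in trace norm *)

Lemma trnorm_ge0 T : bounded_op T -> (0 <= trnorm T)%E.
Proof. by move=> bT; exact: optrace_ge0 (absop_posop bT). Qed.

Lemma nrm_le_trnorm T x : trace_class T -> nrm (T x) <= fine (trnorm T) * nrm x.
Proof.
move=> [bT fT]; have pA := absop_posop bT.
have t0 : 0 <= fine (trnorm T) by rewrite fine_ge0// trnorm_ge0.
apply: nrm_le_ip; first by rewrite mulr_ge0 ?nrm_ge0.
rewrite -absop_nrm// exprMn nrm_sqr expr2 -mulrA.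
have h y := posop_trace_bound y pA fT.
by rewrite (le_trans (posop_sqr_le pA h _))// ler_wpM2l.
Qed.

(** The right side may be infinite, so the bound can be integrated without a case distinction; the
    unit ball keeps the constant equal to 1. *)
Lemma ip_le_trnorm T x y : bounded_op T -> nrm x <= 1 -> nrm y <= 1 ->
  (`|ip (T x) y|%:E <= trnorm T)%E.
Proof.
move=> bT x1 y1; have [fT|] := ltP (trnorm T) +oo%E; last first.
  by rewrite leye_eq => /eqP ->; rewrite leey.
rewrite -(fineK (x := trnorm T)); last by rewrite ge0_fin_numE// trnorm_ge0.
have t0 : 0 <= fine (trnorm T) by rewrite fine_ge0// trnorm_ge0.
rewrite lee_fin (le_trans (cauchy_schwarz _ _))//.
rewrite (le_trans (ler_pM _ _ (nrm_le_trnorm x _) y1)) ?nrm_ge0// mulr1.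
by rewrite -[leRHS]mulr1 ler_wpM2l.
Qed.

Lemma trnorm_pos T : posop T -> trnorm T = optrace T.
Proof. by move=> pT; rewrite /trnorm absop_pos. Qed.

Lemma trnorm_opp T : bounded_op T -> trnorm (- T) = trnorm T.
Proof. by move=> bT; rewrite /trnorm absop_opp. Qed.

Lemma trace_classP T : posop T -> trace_class T <-> (optrace T < +oo)%E.
Proof.
move=> pT; rewrite /trace_class trnorm_pos//; split=> [[]//|h].
by split=> //; exact: posop_bop.
Qed.

Lemma trace_class_le S T : posop S -> posop (T - S) -> posop T -> trace_class T -> trace_class S.
Proof.
move=> pS pTS pT /(trace_classP pT) fT; apply/(trace_classP pS).
exact: le_lt_trans (le_optrace pTS) fT.
Qed.

Lemma tr_cvg_ip (u : nat -> H -> H) L x y : tr_cvg u L ->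
  ip (u n x) y @[n --> \oo] --> ip (L x) y.
Proof.
move=> [tu [bL fL] uL].
have [h1 h2] := (fine_cvgP _ _).1 uL.
apply/subr_cvg0.
apply: (@squeeze_cvgr _ _ _ _
  (fun n => - (fine (trnorm (u n - L)) * (nrm x * nrm y)))
  (fun n => fine (trnorm (u n - L)) * (nrm x * nrm y))).
- near=> n; rewrite -ipBl -ler_norml (le_trans (cauchy_schwarz _ _))//.
  rewrite mulrA ler_wpM2r ?nrm_ge0//; apply: (@nrm_le_trnorm (u n - L)).
  (* That u n - L is trace class is read off from its trace norm, which is finite for large n,
     rather than from a triangle inequality. *)
  have [bn _] := tu n; split; first exact: bop_sub.
  have : trnorm (u n - L) \is a fin_num by near: n.
  by rewrite fin_numElt => /andP[].
- by rewrite -oppr0 -(mul0r (nrm x * nrm y)); apply: cvgN; apply: cvgM => //; exact: cvg_cst.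
- by rewrite -(mul0r (nrm x * nrm y)); apply: cvgM => //; exact: cvg_cst.
Unshelve. all: by end_near. Qed.

Lemma op_inj S T : (forall x y, ip (S x) y = ip (T x) y) -> S = T.
Proof. by move=> h; apply/funext => x; apply: ip_inj => y. Qed.

Lemma tr_cvg_unique (u : nat -> H -> H) L L' : tr_cvg u L -> tr_cvg u L' -> L = L'.
Proof.
move=> uL uL'; apply: op_inj => x y.
by apply: (cvg_unique _ (tr_cvg_ip (x := x) (y := y) uL) (tr_cvg_ip uL')).
Qed.

Lemma tr_limE (u : nat -> H -> H) L : tr_cvg u L -> tr_lim u = L.
Proof.
move=> uL; have := @xgetPex _ 0 [set L | tr_cvg u L] (ex_intro _ _ uL).
by move=> /= h; exact: tr_cvg_unique h uL.
Qed.

Lemma strong_limE (u : nat -> H -> H) L : bounded_op L ->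
  (forall x, u n x @[n --> \oo] --> L x) -> strong_lim u = L.
Proof.
move=> bL uL; have := @xgetPex _ 0
  [set L | bounded_op L /\ forall x, u n x @[n --> \oo] --> L x].
move=> /(_ (ex_intro _ L (conj bL uL)))[_ h].
by apply/funext => x; exact: (cvgH_unique (h x)).
Qed.

Lemma optraceB S T : posop T -> posop (S - T) -> (optrace S < +oo)%E ->
  optrace (S - T) = (optrace S - optrace T)%E.
Proof.
move=> pT pST fS.
have fT : optrace T \is a fin_num.
  by apply: optrace_fin => //; exact: le_lt_trans (le_optrace pST) fS.
have e : optrace S = (optrace (S - T)%R + optrace T)%E by rewrite -optraceD// subrK.
by rewrite e addeK.
Qed.

Lemma cvg_sum_seq (I : Type) (s : seq I) (f : nat -> I -> R) (l : I -> R) :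
  (forall i, f n i @[n --> \oo] --> l i) ->
  \sum_(i <- s) f n i @[n --> \oo] --> \sum_(i <- s) l i.
Proof.
move=> fl; elim: s => [|i s ih].
  by under eq_fun do rewrite big_nil; rewrite big_nil; exact: cvg_cst.
by under eq_fun do rewrite big_cons; rewrite big_cons; apply: cvgD.
Qed.

(* By additivity, tr (T n - L) = tr (T 0 - L) - tr (T 0 - T n), and finitely many
   basis vectors bound the last trace from below. *)
Theorem decreasing_optrace_cvg (T : nat -> H -> H) L :
  (forall n, posop (T n)) -> (forall n, posop (T n - T n.+1)) ->
  (optrace (T 0%N) < +oo)%E -> posop L -> (forall n, posop (T n - L)) ->
  (forall x, T n x @[n --> \oo] --> L x) ->
  optrace (T n - L) @[n --> \oo] --> 0%E.
Proof.
move=> pT dT f0 pL TL TLx.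
have dT' n : posop (T 0%N - T n) by exact: (posop_decr dT 0%N n).
have fT n : (optrace (T n) < +oo)%E by apply: le_lt_trans (le_optrace (dT' n)) f0.
have subfin A B : posop B -> posop (A - B) -> (optrace A < +oo)%E ->
    optrace (A - B) \is a fin_num.
  move=> pB pAB fA; apply: optrace_fin => //; rewrite (le_lt_trans _ fA)// le_optrace//.
  by rewrite opprB addrC subrK.
apply/fine_cvgP; split; first by apply: nearW => n; exact: subfin.
apply/cvgrPdist_lt => e e0.
(* F is chosen for the limit difference T 0 - L; by strong convergence the same F serves T 0 - T n
   once n is large. *)
have [F FB hF] := optrace_adherent e0 (subfin _ _ pL (TL 0%N) f0).
have lim : \sum_(e <- F) ip ((T 0%N - T n) e) e @[n --> \oo] -->
    \sum_(e <- F) ip ((T 0%N - L) e) e.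
  apply: cvg_sum_seq => f; rewrite opE.
  have -> : (fun n => ip ((T 0%N - T n) f) f) = (fun n => ip (T 0%N f - T n f) f) by [].
  by apply: cvg_ipl; apply: cvgB; [exact: cvg_cst|exact: TLx].
near=> n; rewrite sub0r normrN ger0_norm; last by rewrite fine_ge0// optrace_ge0.
have hn : fine (optrace (T 0%N - L)) - e < \sum_(e <- F) ip ((T 0%N - T n) e) e.
  by near: n; apply: (cvgr_gt _ lim).
have := optraceD (dT' n) (TL n); rewrite addrA subrK => e1.
have f1 := subfin _ _ (pT n) (dT' n) f0; have f2 := subfin _ _ pL (TL n) (fT n).
have h : \sum_(e <- F) ip ((T 0%N - T n) e) e <= fine (optrace (T 0%N - T n)).
  by rewrite -lee_fin fineK// optrace_ge_fset.
by move: (lt_le_trans hn h); rewrite e1 fineD//=; lra.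
Unshelve. all: by end_near. Qed.

Corollary decreasing_tr_cvg (T : nat -> H -> H) L :
  (forall n, posop (T n)) -> (forall n, posop (T n - T n.+1)) ->
  (optrace (T 0%N) < +oo)%E -> posop L -> (forall n, posop (T n - L)) ->
  (forall x, T n x @[n --> \oo] --> L x) -> tr_cvg T L.
Proof.
move=> pT dT f0 pL TL TLx.
have t0 : trace_class (T 0%N) by apply/trace_classP.
split=> [n||].
- apply: (trace_class_le (pT n) _ (pT 0%N) t0); exact: (posop_decr dT 0%N n).
- exact: trace_class_le pL (TL 0%N) (pT 0%N) t0.
- under eq_fun do rewrite trnorm_pos//.
  exact: decreasing_optrace_cvg.
Qed.

Lemma tr_cvg_subl B (T : nat -> H -> H) L : posop B -> trace_class B ->
  (forall n, posop (T n)) -> posop L ->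
  (forall n, posop (B - T n)) -> posop (B - L) ->
  tr_cvg T L -> tr_cvg (fun n => B - T n) (B - L).
Proof.
move=> pB tB pT pL pBT pBL [tT tL TL]; split=> [n||].
- apply: (trace_class_le (pBT n) _ pB tB); by rewrite opprB addrC subrK.
- apply: (trace_class_le pBL _ pB tB); by rewrite opprB addrC subrK.
- have -> : (fun n => trnorm (B - T n - (B - L))) = (fun n => trnorm (T n - L)) => //.
  apply/funext => n; rewrite -trnorm_opp; last by apply: bop_sub; exact: posop_bop.
  by congr trnorm; rewrite !opprB addrC addrA subrK.
Qed.

End Trace.

(** * Functions with finitely many values *)

Section FiniteRange.
Context {R : realType} {d : measure_display} {T : measurableType d}.
Context (P : probability T R).

(** The value type carries no sigma-algebra: asking only for measurable level sets makes the notion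
    stable under arbitrary maps, which covers words, operators and scalars alike. *)
Definition finite_valued (V : Type) (q : T -> V) :=
  finite_set (range q) /\ forall v, measurable (q @^-1` [set v]).

Lemma finite_valued_comp (V W : Type) (q : T -> V) (h : V -> W) :
  finite_valued q -> finite_valued (fun t => h (q t)).
Proof.
move=> [finq mq]; split=> [|w].
  apply: sub_finite_set (finite_image h finq).
  by move=> _ [t _ <-]; exists (q t) => //; exists t.
have -> : (fun t => h (q t)) @^-1` [set w] =
    \bigcup_(v in range q `&` [set v | h v = w]) (q @^-1` [set v]).
  apply/seteqP; split=> [t /= <-|t [v [_ /= <-] /= -> //]].
  by exists (q t) => //; split=> //; exists t.
by apply: fin_bigcup_measurable => //; exact: finite_setIl.
Qed.

Lemma finite_valued_pair (V W : Type) (q : T -> V) (r : T -> W) :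
  finite_valued q -> finite_valued r -> finite_valued (fun t => (q t, r t)).
Proof.
move=> [fq mq] [fr mr]; split=> [|[v w]].
  apply: sub_finite_set (finite_setX fq fr).
  by move=> _ [t _ <-]; split; exists t.
have -> : (fun t => (q t, r t)) @^-1` [set (v, w)] =
    (q @^-1` [set v]) `&` (r @^-1` [set w]).
  by apply/seteqP; split=> t /= [-> ->].
exact: measurableI.
Qed.

Lemma finite_valued_measurable (h : T -> R) (E : set T) :
  finite_valued h -> measurable_fun E h.
Proof.
move=> [fh mh]; apply: (measurable_funS measurableT) => // _ Y mY.
rewrite setTI; have -> : h @^-1` Y = \bigcup_(v in range h `&` Y) (h @^-1` [set v]).
  apply/seteqP; split=> [t Yt|t [v [_ Yv] /= -> //]].
  by exists (h t) => //; split=> //; exists t.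
by apply: fin_bigcup_measurable => //; exact: finite_setIl.
Qed.

Lemma finite_valued_bounded (h : T -> R) (E : set T) :
  finite_valued h -> [bounded h t | t in E].
Proof.
move=> [fh _]; have := finite_image (fun r => `|r|) fh.
move=> /finite_seqP[s hs]; exists (\sum_(r <- s) `|r|); split; first exact: num_real.
move=> M sM t Et /=; apply: (le_trans _ (ltW sM)).
have : `|h t| \in s.
  by apply: (_ : [set` s] `|h t|); rewrite -hs; exists (h t) => //; exists t.
by move=> hts; rewrite (big_rem _ hts) /= normr_id lerDl sumr_ge0.
Qed.

Lemma finite_valued_integrable (h : T -> R) (E : set T) : measurable E ->
  finite_valued h -> P.-integrable E (EFin \o h).
Proof.
move=> mE fh; apply: measurable_bounded_integrable => //.
- by rewrite (le_lt_trans (probability_le1 P mE))// ltry.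
- exact: finite_valued_measurable.
- exact: finite_valued_bounded.
Qed.

Lemma integral_finite_valued (V : choiceType) (q : T -> V) (h : V -> R) (E : set T) :
  measurable E -> finite_valued q ->
  (\int[P]_(t in E) (h (q t))%:E)%E =
  (\sum_(v \in range q) h v * fine (P (E `&` q @^-1` [set v])))%:E.
Proof.
move=> mE [fq mq].
have mEq v : measurable (E `&` q @^-1` [set v]) by exact: measurableI.
have EE : E = \big[setU/set0]_(v <- fset_set (range q)) (E `&` q @^-1` [set v]).
  rewrite -bigcup_fset fset_setK// -setI_bigcupr; apply/seteqP; split=> [t Et|t []//].
  by split=> //; exists (q t).
rewrite {1}EE integral_bigsetU_EFin//=; last first.
- apply/measurable_EFinP; apply: finite_valued_measurable.
  exact: (finite_valued_comp h (conj fq mq)).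
- by move=> v w _ _ [t [[_ /= <-] [_ /= <-]]].
- rewrite fsbig_finite//= -sumEFin; apply: eq_bigr => v _.
  rewrite (eq_integral (cst (h v)%:E)) => [|t]; last first.
    by move=> /set_mem[_ /= ->].
  rewrite integral_cst// EFinM fineK// fin_num_measure//.
Qed.

(* Neither function need be measurable; [trnorm (s n t - f t)] in [is_bochner] is
   not known to be. *)
Lemma nneg_le_integral (f g : T -> \bar R) (E : set T) :
  (forall t, E t -> 0 <= f t)%E -> (forall t, E t -> f t <= g t)%E ->
  (\int[P]_(t in E) f t <= \int[P]_(t in E) g t)%E.
Proof.
move=> f0 fg.
have g0 t : E t -> (0 <= g t)%E by move=> Et; exact: le_trans (f0 t Et) (fg t Et).
rewrite !ge0_integralE//; apply: le_ereal_sup => _ [h hf <-]; exists h => // t.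
apply: (le_trans (hf t)); rewrite /patch; case: ifPn => // /set_mem; exact: fg.
Qed.

End FiniteRange.

(** * Bochner integrals of monotone sequences *)

Section BochnerFacts.
Context {R : realType} {H : hilbertType R} {d : measure_display}.
Context {T : measurableType d} (P : probability T R).
Implicit Types (x y : H) (E : set T) (s r f : T -> H -> H) (B I : H -> H).

(** The weak identities for Bochner integrals are available on the unit ball; real scaling extends
    them to all vectors. *)
Lemma op_inj_ball (S S' : H -> H) : bounded_op S -> bounded_op S' ->
  (forall x y, nrm x <= 1 -> nrm y <= 1 -> ip (S x) y = ip (S' x) y) -> S = S'.
Proof.
move=> bS bS' h.
have norm1 x : exists2 u : H, nrm u <= 1 & x = (nrm x)%:C *: u.
  have [x0|x0] := eqVneq (nrm x) 0.
    by exists 0; rewrite ?nrm0 ?ler01// scaler0 (nrm_eq0 x0).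
  exists ((nrm x)^-1%:C *: x); last by rewrite scalerA -rmorphM /= divff// scale1r.
  by rewrite nrmZ ger0_norm ?invr_ge0 ?nrm_ge0// mulVf.
apply: op_inj => x y; have [u u1 ->] := norm1 x; have [v v1 ->] := norm1 y.
by rewrite (bopZ bS) (bopZ bS') !ipZl !ipZr h.
Qed.

Lemma simple_op_finite_valued s : simple_op s -> finite_valued s.
Proof. by case. Qed.

Lemma finite_valued_simple_op s : finite_valued s -> (forall t, trace_class (s t)) ->
  simple_op s.
Proof. by case. Qed.

Lemma finite_valued_sub s r : finite_valued s -> finite_valued r ->
  finite_valued (fun t => s t - r t).
Proof.
move=> fs fr.
exact: (finite_valued_comp (fun p => p.1 - p.2) (finite_valued_pair fs fr)).
Qed.

Lemma finite_valued_cst (V : Type) (v : V) : finite_valued (fun _ : T => v).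
Proof.
split; first by apply: sub_finite_set (finite_set1 v) => _ [t _ <-].
move=> w; have [->|vw] := pselect (v = w).
  by have -> : (fun=> w) @^-1` [set w] = [set: T] by apply/seteqP; split.
by have -> : (fun=> v) @^-1` [set w] = (set0 : set T) by apply/seteqP; split.
Qed.

Lemma ip_simple_integral E s x y : measurable E -> finite_valued s ->
  (ip (simple_integral P E s x) y)%:E = (\int[P]_(t in E) (ip (s t x) y)%:E)%E.
Proof.
move=> mE fs; have [fin _] := fs.
rewrite (integral_finite_valued P (fun v : H -> H => ip (v x) y) mE fs).
rewrite /simple_integral !fsbig_finite//= fct_sumE ip_suml; congr EFin.
by apply: eq_bigr => v _; rewrite opE ipZl mulrC.
Qed.

Lemma simple_integral_posop E s : finite_valued s -> (forall t, posop (s t)) ->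
  posop (simple_integral P E s).
Proof.
move=> [fin _] ps; rewrite /simple_integral fsbig_finite//= big_seq.
apply: posop_sum => v; rewrite in_fset_set// => /set_mem[t _ <-].
by apply: posop_scale => //; rewrite fine_ge0.
Qed.

Lemma optrace_simple_integral E s : measurable E -> finite_valued s ->
  (forall t, posop (s t)) -> (forall t, optrace (s t) < +oo)%E ->
  optrace (simple_integral P E s) = (\int[P]_(t in E) (fine (optrace (s t)))%:E)%E.
Proof.
move=> mE fs ps ts; have [fin _] := fs.
rewrite (integral_finite_valued P (fun v : H -> H => fine (optrace v)) mE fs).
rewrite /simple_integral !fsbig_finite//= -sumEFin big_seq optrace_sum; last first.
  move=> v; rewrite in_fset_set// => /set_mem[t _ <-].
  by apply: posop_scale => //; rewrite fine_ge0.
rewrite [RHS]big_seq; apply: eq_bigr => v; rewrite in_fset_set// => /set_mem[t _ <-].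
by rewrite optraceZ ?fine_ge0// -{1}(fineK (optrace_fin (ps t) (ts t))) -EFinM mulrC.
Qed.

(** The three integrals are sums over three different ranges; testing against vectors replaces a
    common refinement by additivity of the scalar integral. *)
Lemma simple_integralB E s r : measurable E -> finite_valued s -> finite_valued r ->
  simple_integral P E (fun t => s t - r t) =
  simple_integral P E s - simple_integral P E r.
Proof.
move=> mE fs fr; apply: op_inj => x y; apply: EFin_inj.
rewrite ip_simple_integral//; last exact: finite_valued_sub.
rewrite opE ipBl EFinB !ip_simple_integral// -integralB_EFin//.
- by apply: eq_integral => t _; rewrite opE ipBl EFinB.
- apply: finite_valued_integrable => //.
  exact: (finite_valued_comp (fun v : H -> H => ip (v x) y)).
- apply: finite_valued_integrable => //.
  exact: (finite_valued_comp (fun v : H -> H => ip (v x) y)).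
Qed.

Lemma simple_integral_cst E B : measurable E ->
  simple_integral P E (fun=> B) = (fine (P E))%:C *: B.
Proof.
move=> mE; apply: op_inj => x y; apply: EFin_inj.
rewrite ip_simple_integral//; last exact: finite_valued_cst.
by rewrite integral_cst// opE ipZl mulrC EFinM fineK// fin_num_measure.
Qed.

(** For unit vectors the scalar integrals of s n and f differ by at most the integral of the trace
    norm of s n - f, which tends to 0, while trace-norm convergence of the simple integrals gives
    the left side. *)
Lemma is_bochner_weak E f I x y : measurable E -> is_bochner P E f I ->
  (forall t, bounded_op (f t)) -> nrm x <= 1 -> nrm y <= 1 ->
  P.-integrable E (fun t => (ip (f t x) y)%:E) ->
  (ip (I x) y)%:E = (\int[P]_(t in E) (ip (f t x) y)%:E)%E.
Proof.
move=> mE [_ [s [ss sf sI]]] bf x1 y1 intf; set J := (RHS).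
have fJ : J \is a fin_num by exact: integrable_fin_num.
have cv1 : (ip (simple_integral P E (s n) x) y)%:E @[n --> \oo] --> (ip (I x) y)%:E.
  by apply: cvg_EFin; [exact: nearW|exact: (tr_cvg_ip sI)].
have ints n : P.-integrable E (fun t => (ip (s n t x) y)%:E).
  apply: finite_valued_integrable => //.
  apply: (finite_valued_comp (fun v : H -> H => ip (v x) y)).
  exact: simple_op_finite_valued.
suff cv2 : (ip (simple_integral P E (s n) x) y)%:E @[n --> \oo] --> J.
  exact: (cvg_unique _ cv1 cv2).
suff : (`|(ip (simple_integral P E (s n) x) y)%:E - J|)%E @[n --> \oo] --> 0%E.
  by move/cvg_abse0P/sube_cvg0; apply.
apply: (@squeeze_cvge _ _ _ _ (cst 0%E) _
   (fun n => \int[P]_(t in E) trnorm (s n t - f t)%R)%E) => //; last exact: cvg_cst.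
apply: nearW => n; rewrite abse_ge0 /=.
rewrite ip_simple_integral//; last exact: simple_op_finite_valued.
rewrite -integralB_EFin//; last exact: ints.
apply: (le_trans (le_abse_integral P mE _)).
  by apply: emeasurable_funB; [have /integrableP[] := ints n|have /integrableP[] := intf].
apply: nneg_le_integral => t Et; first exact: abse_ge0.
rewrite -EFinB -ipBl; apply: (ip_le_trnorm (T := s n t - f t)) => //.
by apply: bop_sub => //; have [_ _ /(_ t)[]] := ss n.
Qed.

Lemma is_bochner_bop E f I : is_bochner P E f I -> bounded_op I.
Proof. by move=> [_ [s [_ _ [_ []]]]]. Qed.

Lemma bochnerE E f I : measurable E -> (forall t, bounded_op (f t)) ->
  (forall x y, nrm x <= 1 -> nrm y <= 1 ->
     P.-integrable E (fun t => (ip (f t x) y)%:E)) ->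
  is_bochner P E f I -> bochner P E f = I.
Proof.
move=> mE bf intf hI.
have h : is_bochner P E f (bochner P E f) := @xgetPex _ 0 [set I | is_bochner P E f I] (ex_intro _ _ hI).
apply: op_inj_ball; [exact: is_bochner_bop h|exact: is_bochner_bop hI|].
move=> x y x1 y1; apply: EFin_inj.
by rewrite (is_bochner_weak mE h)// ?(is_bochner_weak mE hI)//; exact: intf.
Qed.

Lemma trnorm0 : trnorm (0 : H -> H) = 0%E.
Proof. by rewrite trnorm_pos ?optrace0//; exact: posop0. Qed.

Lemma tr_cvg_cst B : trace_class B -> tr_cvg (fun=> B) B.
Proof. by move=> tB; split=> //; rewrite subrr trnorm0; exact: cvg_cst. Qed.

Lemma is_bochner_simple E s : simple_op s -> (forall t, posop (s t)) -> measurable E ->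
  is_bochner P E s (simple_integral P E s).
Proof.
move=> ss ps mE; have [_ _ ts] := ss; split.
  exists (fun=> s); split=> //; apply: aeW => t _; exact: tr_cvg_cst.
exists (fun=> s); split=> //.
  have -> : (\int[P]_(t in E) trnorm (s t - s t)%R = 0)%E.
    rewrite -[RHS](integral0 P E); apply: eq_integral => t _.
    by rewrite subrr trnorm0.
  exact: cvg_cst.
apply: tr_cvg_cst; apply/trace_classP.
  by apply: simple_integral_posop => //; exact: simple_op_finite_valued.
have tfin t : (optrace (s t) < +oo)%E by apply/(trace_classP (ps t)).
rewrite optrace_simple_integral//; last exact: simple_op_finite_valued.
rewrite (integral_finite_valued P (fun v : H -> H => fine (optrace v)) mE
  (simple_op_finite_valued ss)).
exact: ltry.
Qed.

(** * Decreasing sequences of finite-valued functions with a constant first term *)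

Section DecreasingLimit.
Variables (B : H -> H) (s : nat -> T -> H -> H) (f : T -> H -> H).
Hypotheses (pB : posop B) (tB : trace_class B).
Hypothesis fs : forall n, finite_valued (s n).
Hypothesis s0 : forall t, s 0%N t = B.
Hypothesis ps : forall n t, posop (s n t).
Hypothesis ds : forall n t, posop (s n t - s n.+1 t).
Hypothesis pf : forall t, posop (f t).
Hypothesis sf : forall n t, posop (s n t - f t).
Hypothesis sfx : forall t x, s n t x @[n --> \oo] --> f t x.

Let fB : (optrace B < +oo)%E. Proof. exact/trace_classP. Qed.

Let Bf t : posop (B - f t). Proof. by rewrite -(s0 t). Qed.

Let Bs n t : posop (B - s n t).
Proof. by rewrite -(s0 t); exact: (posop_decr (fun n => ds n t) 0%N n). Qed.

Let fins n t : (optrace (s n t) < +oo)%E.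
Proof. exact: le_lt_trans (le_optrace (Bs n t)) fB. Qed.

Let finf t : (optrace (f t) < +oo)%E.
Proof. exact: le_lt_trans (le_optrace (Bf t)) fB. Qed.

Lemma decreasing_simple_op n : simple_op (s n).
Proof. by apply: finite_valued_simple_op => // t; exact/trace_classP. Qed.

Lemma decreasing_tr_cvg_lim t : tr_cvg (fun n => s n t) (f t).
Proof.
exact: (decreasing_tr_cvg (ps^~ t) (ds^~ t) (fins 0%N t) (pf t) (sf^~ t) (@sfx t)).
Qed.

Lemma fine_optrace_cvg t :
  fine (optrace (s n t)) @[n --> \oo] --> fine (optrace (f t)).
Proof.
have [_ h] : (\forall n \near \oo, optrace (s n t - f t) \is a fin_num) /\
    (fine \o (fun n => optrace (s n t - f t))) @ \oo --> 0.
  apply/fine_cvgP.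
  exact: (decreasing_optrace_cvg (ps^~ t) (ds^~ t) (fins 0%N t) (pf t) (sf^~ t) (@sfx t)).
apply/subr_cvg0; apply: cvg_trans h; apply: near_eq_cvg; apply: nearW => n /=.
by rewrite optraceB// fineB// optrace_fin.
Qed.

Lemma measurable_optrace_lim E : measurable_fun E (fun t => fine (optrace (f t))).
Proof.
apply: (@measurable_fun_cvg _ _ _ _ (fun n t => fine (optrace (s n t)))).
  move=> n; apply: finite_valued_measurable.
  exact: (finite_valued_comp (fun v : H -> H => fine (optrace v))).
by move=> t _; exact: fine_optrace_cvg.
Qed.

Let le_tr n t : `|fine (optrace (s n t))| <= fine (optrace B).
Proof.
rewrite ger0_norm ?fine_ge0 ?optrace_ge0//.
by rewrite fine_le ?optrace_fin// le_optrace.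
Qed.

Let le_trf t : `|fine (optrace (f t))| <= fine (optrace B).
Proof.
rewrite ger0_norm ?fine_ge0 ?optrace_ge0//.
by rewrite fine_le ?optrace_fin// le_optrace.
Qed.

Let int_cst E (c : R) : measurable E -> P.-integrable E (fun=> c%:E).
Proof.
move=> mE; apply: (@finite_valued_integrable _ _ _ P (fun=> c)) => //.
exact: finite_valued_cst.
Qed.

Lemma optrace_lim_integrable E : measurable E ->
  P.-integrable E (fun t => (fine (optrace (f t)))%:E).
Proof.
move=> mE; apply: (le_integrable mE _ _ (int_cst (fine (optrace B)) mE)).
  by apply/measurable_EFinP; exact: measurable_optrace_lim.
by move=> t _; rewrite !abse_EFin lee_fin (le_trans (le_trf t))// ler_norm.
Qed.

Lemma integral_optrace_cvg E : measurable E ->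
  (\int[P]_(t in E) (fine (optrace (s n t)))%:E)%E @[n --> \oo] -->
  (\int[P]_(t in E) (fine (optrace (f t)))%:E)%E.
Proof.
move=> mE; apply: (@dominated_cvg _ _ _ _ _ mE _ _ (fun=> (fine (optrace B))%:E)) => //.
- move=> n; apply/measurable_EFinP; apply: finite_valued_measurable.
  exact: (finite_valued_comp (fun v : H -> H => fine (optrace v))).
- move=> t _; apply: cvg_EFin; first exact: nearW.
  exact: fine_optrace_cvg.
- exact: int_cst.
- by move=> n t _; rewrite lee_fin.
Qed.

(** Since s n >= f, the trace norm is pointwise tr (s n) - tr f, a difference of integrable
    functions whose integrals converge. *)
Lemma integral_trnorm_cvg E : measurable E ->
  (\int[P]_(t in E) trnorm (s n t - f t)%R)%E @[n --> \oo] --> 0%E.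
Proof.
move=> mE.
have -> : (fun n => \int[P]_(t in E) trnorm (s n t - f t)%R)%E =
  (fun n => \int[P]_(t in E) (fine (optrace (s n t)))%:E -
            \int[P]_(t in E) (fine (optrace (f t)))%:E)%E.
  apply/funext => n; rewrite -integralB_EFin//; last exact: optrace_lim_integrable.
    apply: eq_integral => t _.
    by rewrite trnorm_pos// optraceB// !fineK// optrace_fin.
  apply: finite_valued_integrable => //.
  exact: (finite_valued_comp (fun v : H -> H => fine (optrace v))).
have fin := integrable_fin_num mE (optrace_lim_integrable mE).
apply/sube_cvg0 => //.
exact: integral_optrace_cvg.
Qed.

Lemma lim_ip_integrable E x y : measurable E -> nrm x <= 1 -> nrm y <= 1 ->
  P.-integrable E (fun t => (ip (f t x) y)%:E).
Proof.
move=> mE x1 y1; apply: (le_integrable mE _ _ (int_cst (fine (optrace B)) mE)).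
  apply/measurable_EFinP.
  apply: (@measurable_fun_cvg _ _ _ _ (fun n t => ip (s n t x) y)).
    move=> n; apply: finite_valued_measurable.
    exact: (finite_valued_comp (fun v : H -> H => ip (v x) y)).
  by move=> t _; exact: cvg_ipl.
move=> t _; rewrite !abse_EFin [in leRHS]ger0_norm ?fine_ge0 ?optrace_ge0//.
rewrite fineK ?optrace_fin//.
apply: le_trans (ip_le_trnorm (posop_bop (pf t)) x1 y1) _.
by rewrite trnorm_pos// le_optrace.
Qed.

(** The integral of B - f, the shape of [Sigma], is built directly from the approximants B - s n, so
    linearity of the Bochner integral is not called upon. *)
Theorem bochner_decreasing_lim E : measurable E ->
  let c := (fine (P E))%:C in
  exists I, [/\ posop I, posop (c *: B - I),
    tr_cvg (fun n => simple_integral P E (s n)) I,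
    is_bochner P E f I /\ is_bochner P E (fun t => B - f t) (c *: B - I) &
    optrace I = (\int[P]_(t in E) (fine (optrace (f t)))%:E)%E].
Proof.
move=> mE c; pose S n := simple_integral P E (s n).
have pS n : posop (S n) by exact: simple_integral_posop.
have dS n : posop (S n - S n.+1).
  by rewrite -simple_integralB//; apply: simple_integral_posop => //; exact: finite_valued_sub.
have S0 : S 0%N = c *: B.
  by rewrite /S -simple_integral_cst//; congr simple_integral; apply/funext.
have pcB : posop (c *: B) by rewrite -S0.
have tS0 : (optrace (S 0%N) < +oo)%E.
  rewrite S0 optraceZ ?fine_ge0// lte_mul_pinfty ?lee_fin ?fine_ge0//.
have [I [pI SI IS]] := decreasing_posop_cvg pS dS.
have trI : tr_cvg S I by exact: decreasing_tr_cvg.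
have bI : is_bochner P E f I.
  split; last by exists s; split=> //; [exact: decreasing_simple_op|exact: integral_trnorm_cvg].
  exists s; split; first exact: decreasing_simple_op.
  by apply: aeW => t _; exact: decreasing_tr_cvg_lim.
have tBs n t : trace_class (B - s n t).
  by apply: (trace_class_le (Bs n t) _ pB tB); rewrite opprB addrC subrK.
have sBs n : simple_op (fun t => B - s n t).
  apply: finite_valued_simple_op => //; apply: finite_valued_sub => //.
  exact: finite_valued_cst.
have pcBS n : posop (c *: B - S n) by rewrite -S0; exact: (posop_decr dS 0%N n).
have tcB : trace_class (c *: B) by apply/trace_classP; rewrite -?S0.
exists I; split=> //; first by rewrite -S0.
  split=> //; split.
    exists (fun n t => B - s n t); split=> //; apply: aeW => t _.
    by apply: tr_cvg_subl => //; exact: decreasing_tr_cvg_lim.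
  exists (fun n t => B - s n t); split=> //.
    have -> : (fun n => \int[P]_(t in E) trnorm (B - s n t - (B - f t))%R)%E =
        (fun n => \int[P]_(t in E) trnorm (s n t - f t)%R)%E.
      apply/funext => n; apply: eq_integral => t _.
      rewrite -trnorm_opp; last by do 2?apply: bop_sub; exact: posop_bop.
      by congr trnorm; rewrite !opprB addrC addrA subrK.
    exact: integral_trnorm_cvg.
  have -> : (fun n => simple_integral P E (fun t => B - s n t)) = (fun n => c *: B - S n).
    apply/funext => n; rewrite (simple_integralB (s := fun=> B))//; last exact: finite_valued_cst.
    by rewrite simple_integral_cst.
  by apply: tr_cvg_subl => //; rewrite -S0.
(* The traces of S n have two descriptions of their limit: the integral of tr f by dominated
   convergence, and tr I by decreasing convergence of S n. *)
have h1 := integral_optrace_cvg mE.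
have h2 : optrace (S n) @[n --> \oo] --> optrace I.
  have fI : optrace I \is a fin_num.
    by apply: optrace_fin => //; have [_ [_]] := trI; rewrite trnorm_pos.
  have := decreasing_optrace_cvg pS dS tS0 pI IS SI.
  have -> : (fun n => optrace (S n - I)) = (fun n => optrace (S n) - optrace I)%E.
    apply/funext => n; apply: optraceB => //.
    exact: le_lt_trans (le_optrace (posop_decr dS 0%N n)) tS0.
  by move/sube_cvg0; apply.
have e : (fun n => optrace (S n)) = (fun n => \int[P]_(t in E) (fine (optrace (s n t)))%:E)%E.
  by apply/funext => n; exact: optrace_simple_integral.
rewrite e in h2; exact: (cvg_unique _ h2 h1).
Qed.

End DecreasingLimit.
End BochnerFacts.

(** * Paths *)

Section PathWords.
Context {m : nat}.
Implicit Types (u : seq 'I_m.+1) (w : path_space m).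

Lemma nonzero_prefix_stop u a : ord0 \in u ->
  nonzero_prefix (rcons u a) = nonzero_prefix u.
Proof.
move=> u0; rewrite /nonzero_prefix -cats1 index_cat u0 take_cat.
by rewrite index_mem u0.
Qed.

Lemma nonzero_prefix_nonzero u : ord0 \notin u ->
  nonzero_prefix u = pmap (unlift ord0) u.
Proof. by move=> u0; rewrite /nonzero_prefix memNindex// take_size. Qed.

Lemma nonzero_prefix_rcons0 u : ord0 \notin u ->
  nonzero_prefix (rcons u ord0) = nonzero_prefix u.
Proof.
move=> u0; rewrite [RHS]nonzero_prefix_nonzero//.
rewrite /nonzero_prefix -cats1 index_cat (negbTE u0) /= addn0 take_cat.
by rewrite ltnn subnn take0 cats0.
Qed.

Lemma nonzero_prefix_rcons_lift u j : ord0 \notin u ->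
  nonzero_prefix (rcons u (lift ord0 j)) = rcons (nonzero_prefix u) j.
Proof.
move=> u0; rewrite !nonzero_prefix_nonzero//; last first.
  by rewrite mem_rcons inE negb_or u0 andbT neq_lift.
by rewrite -cats1 pmap_cat /= liftK cats1.
Qed.

Lemma path_prefixS w n : path_prefix w n.+1 = rcons (path_prefix w n) (letter w n.+1).
Proof.
have iotaS : iota 1 n.+1 = rcons (iota 1 n) n.+1.
  by rewrite -[in LHS](addn1 n) iotaD add1n cats1.
by rewrite /path_prefix iotaS map_rcons.
Qed.

Lemma letter_finite_valued n : finite_valued (fun w : borel_path m => letter w n).
Proof.
split; first exact: finite_finset.
move=> a; apply: sub_sigma_algebra; rewrite /letter.
apply: (@open_comp (path_space m) (discrete_topology 'I_m.+1) (proj n.-1) [set a]).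
  by move=> w _; exact: proj_continuous.
exact: discrete_open.
Qed.

Lemma path_prefix_finite_valued n : finite_valued (fun w : borel_path m => path_prefix w n).
Proof.
elim: n => [|n ih]; first exact: finite_valued_cst.
under [X in finite_valued X]funext do rewrite path_prefixS.
exact: (finite_valued_comp (fun p => rcons p.1 p.2)
  (finite_valued_pair ih (letter_finite_valued n.+1))).
Qed.

Lemma measurable_cylinder u : measurable (cylinder u).
Proof. by have [_] := path_prefix_finite_valued (size u); exact. Qed.

Lemma cylinder_rcons u :
  cylinder u = \big[setU/set0]_(a <- index_enum 'I_m.+1) cylinder (rcons u a).
Proof.
rewrite -bigcup_seq; apply/seteqP; split=> [w uw|w [a _]].
  exists (letter w (size u).+1); first by rewrite /= mem_index_enum.
  by rewrite /cylinder /= size_rcons path_prefixS uw.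
by rewrite /cylinder /= size_rcons path_prefixS => /rcons_inj[].
Qed.

Lemma trivIset_cylinder_rcons u (D : set 'I_m.+1) :
  trivIset D (fun a => cylinder (rcons u a)).
Proof.
move=> a b _ _ [w []]; rewrite /cylinder /= !size_rcons => -> /rcons_inj[].
by [].
Qed.

Lemma tau_le_letter {R : realType} w n : ~~ (n%:R%:E < tau w :> \bar R)%E ->
  exists2 k, (1 <= k <= n)%N & letter w k = ord0.
Proof.
rewrite -leNgt => h.
(* The strict bound by n.+1 yields an actual index of the infimum, and k < n.+1 means k <= n. *)
have : (tau w < n.+1%:R%:E :> \bar R)%E.
  by rewrite (le_lt_trans h)// lte_fin ltr_nat.
move=> /ereal_inf_lt[_ [k [k1 wk] <-]]; rewrite lte_fin ltr_nat ltnS => kn.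
by exists k => //; rewrite k1.
Qed.

End PathWords.

Section RandomPath.
Context {R : realType} {H : hilbertType R} {m : nat}.
Variables (C : 'I_m -> H -> H) (R0 : H -> H).
Hypotheses (C_contraction : forall j, contraction_op (C j)) (R0_pos : posop R0).
Implicit Types (u : seq 'I_m.+1) (w : path_space m).

Lemma R_step_diff (A : H -> H) j : posop A ->
  A - R_step C A j = sqrtop A \o adj (C j) \o C j \o sqrtop A.
Proof.
move=> pA; have [pB BB] := sqrtopP pA; apply/funext => x.
have -> : (A - R_step C A j) x = A x -
    sqrtop A (sqrtop A x - adj (C j) (C j (sqrtop A x))) by [].
rewrite (bopB (posop_bop pB)); have /= -> := congr1 (@^~ x) BB.
by rewrite subKr.
Qed.

Lemma posop_R_step_diff (A : H -> H) j : posop A -> posop (A - R_step C A j).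
Proof.
move=> pA; rewrite R_step_diff//; have [pB _] := sqrtopP pA.
have [bC _] := C_contraction j.
exact: (posop_conj (posop_bop pB) (posop_bop pB) (posop_sym pB) (posop_adj_comp bC)).
Qed.

Lemma posop_R_step (A : H -> H) j : posop A -> posop (R_step C A j).
Proof.
move=> pA; have [pB _] := sqrtopP pA; have [bC cC] := C_contraction j.
apply: (posop_conj (posop_bop pB) (posop_bop pB) (posop_sym pB)).
have pCC := posop_adj_comp bC; apply/posopP; split=> [|x y|x].
- by apply: bop_sub; [exact: bop_id|exact: posop_bop].
- by rewrite !opE ipBl ipBr (posop_sym pCC).
- rewrite opE ipBl subr_ge0 ipC; have [_ <-] := adjP bC.
  rewrite -!nrm_sqr ler_sqr ?nnegrE ?nrm_ge0//.
  by have := cC x; rewrite !normE lecR.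
Qed.

Lemma R_word_rcons v j : R_word C R0 (rcons v j) = R_step C (R_word C R0 v) j.
Proof. by rewrite /R_word foldl_rcons. Qed.

Lemma posop_R_word v : posop (R_word C R0 v).
Proof. by elim/last_ind: v => // v j ih; rewrite R_word_rcons; exact: posop_R_step. Qed.

Lemma posop_R_path u : posop (R_path C R0 u). Proof. exact: posop_R_word. Qed.

Lemma R_path_stop u a : ord0 \in u -> R_path C R0 (rcons u a) = R_path C R0 u.
Proof. by move=> u0; rewrite /R_path nonzero_prefix_stop. Qed.

Lemma R_path_rcons0 u : R_path C R0 (rcons u ord0) = R_path C R0 u.
Proof.
have [u0|u0] := boolP (ord0 \in u); first exact: R_path_stop.
by rewrite /R_path nonzero_prefix_rcons0.
Qed.

Lemma R_path_rcons_lift u j : ord0 \notin u ->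
  R_path C R0 (rcons u (lift ord0 j)) = R_word C R0 (rcons (nonzero_prefix u) j).
Proof. by move=> u0; rewrite /R_path nonzero_prefix_rcons_lift. Qed.

(** One formula for all letters: R does not move at the letter 0 or after it, so the increment
    vanishes there as [D_path] requires. *)
Lemma D_pathE u a : D_path C R0 u a = R_path C R0 u - R_path C R0 (rcons u a).
Proof.
rewrite /D_path; case: ifPn => [u0|u0]; first by rewrite R_path_stop// subrr.
case: unliftP => [j ->|->]; last by rewrite R_path_rcons0 subrr.
by rewrite R_path_rcons_lift// R_word_rcons R_step_diff//; exact: posop_R_word.
Qed.

Lemma posop_D_path u a : posop (D_path C R0 u a).
Proof.
rewrite D_pathE; have [u0|u0] := boolP (ord0 \in u).
  by rewrite R_path_stop// subrr; exact: posop0.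
case: (unliftP ord0 a) => [j ->|->]; last by rewrite R_path_rcons0 subrr; exact: posop0.
by rewrite R_path_rcons_lift// R_word_rcons; apply: posop_R_step_diff; exact: posop_R_word.
Qed.

Lemma R_0 w : R_ C R0 0 w = R0. Proof. by []. Qed.

Lemma posop_R_ n w : posop (R_ C R0 n w). Proof. exact: posop_R_path. Qed.

Lemma D_SE n w : D_ C R0 n.+1 w = R_ C R0 n w - R_ C R0 n.+1 w.
Proof. by rewrite /D_ D_pathE /R_ path_prefixS. Qed.

Lemma posop_R_decr n w : posop (R_ C R0 n w - R_ C R0 n.+1 w).
Proof. by rewrite -D_SE; exact: posop_D_path. Qed.

Lemma R_finite_valued n : finite_valued (fun w : borel_path m => R_ C R0 n w).
Proof. exact: (finite_valued_comp (R_path C R0) (path_prefix_finite_valued n)). Qed.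

(** At [tau] the letter is 0 and R does not change; beyond it the prefix contains 0. So the cutoff
    in [Sigma_partial] removes only zero terms. *)
Lemma D_eq0_after_tau n w : ~~ (n.+1%:R%:E < tau w :> \bar R)%E -> D_ C R0 n.+1 w = 0.
Proof.
move=> /tau_le_letter[k /andP[k1]]; rewrite leq_eqVlt => /predU1P[->|kn] wk.
  by rewrite /D_ wk D_pathE R_path_rcons0 subrr.
rewrite /D_ /D_path /=; suff -> : ord0 \in path_prefix w n by [].
by rewrite -wk; apply: map_f; rewrite mem_iota k1 add1n.
Qed.

Lemma Sigma_partialE N w : Sigma_partial C R0 w N = R0 - R_ C R0 N w.
Proof.
rewrite /Sigma_partial big_mkcond /=.
elim: N => [|N ih]; first by rewrite big_geq// R_0 subrr.
rewrite big_nat_recr//= ih; case: ifPn => [_|/D_eq0_after_tau D0].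
  by rewrite D_SE addrA subrK.
have : R_ C R0 N w - R_ C R0 N.+1 w = 0 by rewrite -D_SE.
by move/subr0_eq => ->; rewrite addr0.
Qed.

Lemma R_inftyP w : [/\ posop (R_infty C R0 w),
  (forall x, R_ C R0 n w x @[n --> \oo] --> R_infty C R0 w x) &
  forall n, posop (R_ C R0 n w - R_infty C R0 w)].
Proof.
have [L [pL RL LR]] := decreasing_posop_cvg (posop_R_^~ w) (posop_R_decr^~ w).
suff -> : R_infty C R0 w = L by [].
exact: (strong_limE (posop_bop pL) RL).
Qed.

End RandomPath.

(** * The dissipation measure *)

Section Dissipation.
Context {R : realType} {H : hilbertType R} {m : nat}.
Variables (C : 'I_m -> H -> H) (R0 : H -> H).
Hypotheses (C_contraction : forall j, contraction_op (C j)) (R0_pos : posop R0).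
Hypothesis R0_trace_class : trace_class R0.
Variable nu : probability (borel_path m) R.
Implicit Types (u : seq 'I_m.+1) (w : path_space m) (E : set (borel_path m)).

Let Rn n w := R_ C R0 n w.
Let Rinf := R_infty C R0.
Let fR n : finite_valued (fun w : borel_path m => Rn n w) := R_finite_valued C R0 n.
Let pR n w : posop (Rn n w) := posop_R_ C_contraction R0_pos n w.
Let dR n w : posop (Rn n w - Rn n.+1 w) := posop_R_decr C_contraction R0_pos n w.
Let R0E w : Rn 0 w = R0 := erefl.

Lemma posop_R_infty w : posop (R_infty C R0 w).
Proof. by have [] := R_inftyP C_contraction R0_pos w. Qed.

Let sR n w : posop (Rn n w - Rinf w).
Proof. by have [_ _] := R_inftyP C_contraction R0_pos w; exact. Qed.

Let lR w x : Rn n w x @[n --> \oo] --> Rinf w x.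
Proof. by have [_ h _] := R_inftyP C_contraction R0_pos w; exact: h. Qed.

Let tR0 : (optrace R0 < +oo)%E. Proof. exact/trace_classP. Qed.

Let R0R w : posop (R0 - Rinf w). Proof. exact: (sR 0 w). Qed.

Let mass E : R[i] := (fine (nu E))%:C.

Lemma R_infty_ip_integrable E (x y : H) : measurable E -> nrm x <= 1 -> nrm y <= 1 ->
  nu.-integrable E (fun w => (ip (R_infty C R0 w x) y)%:E).
Proof.
exact: (lim_ip_integrable nu R0_pos R0_trace_class fR R0E posop_R_infty sR (@lR)).
Qed.

Lemma R_infty_trace_integrable E : measurable E ->
  nu.-integrable E (fun w => (fine (optrace (R_infty C R0 w)))%:E).
Proof.
exact: (optrace_lim_integrable nu R0_pos R0_trace_class fR R0E pR dR posop_R_infty sR (@lR)).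
Qed.

Lemma R_infty_integral_trace_cvg E : measurable E ->
  (\int[nu]_(w in E) (fine (optrace (R_ C R0 n w)))%:E)%E @[n --> \oo] -->
  (\int[nu]_(w in E) (fine (optrace (R_infty C R0 w)))%:E)%E.
Proof.
exact: (integral_optrace_cvg R0_pos R0_trace_class fR R0E pR dR posop_R_infty sR (@lR)).
Qed.

Lemma R_infty_bochnerP E : measurable E ->
  let I := bochner nu E (R_infty C R0) in
  [/\ posop I, posop (mass E *: R0 - I),
    tr_cvg (fun n => simple_integral nu E (R_ C R0 n)) I,
    is_bochner nu E (R_infty C R0) I /\
    is_bochner nu E (fun w => R0 - R_infty C R0 w) (mass E *: R0 - I) &
    optrace I = (\int[nu]_(w in E) (fine (optrace (R_infty C R0 w)))%:E)%E].
Proof.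
move=> mE I.
have [J [pJ cJ tJ [bJ sJ] oJ]] :=
  bochner_decreasing_lim nu R0_pos R0_trace_class fR R0E pR dR posop_R_infty sR (@lR) mE.
suff -> : I = J by [].
apply: bochnerE => // [w|x y x1 y1]; first exact: posop_bop (posop_R_infty w).
exact: R_infty_ip_integrable.
Qed.

(** This holds on every path, so no exceptional null set has to be tracked. *)
Lemma tr_cvg_Sigma_partial w :
  tr_cvg (Sigma_partial C R0 w) (R0 - R_infty C R0 w).
Proof.
have -> : Sigma_partial C R0 w = (fun n => R0 - Rn n w).
  by apply/funext => n; rewrite Sigma_partialE.
apply: (tr_cvg_subl R0_pos R0_trace_class (pR^~ w) (posop_R_infty w) _ (R0R w)) => [n|].
  exact: (posop_decr (fun n => dR n w) 0%N n).
exact: (decreasing_tr_cvg (pR^~ w) (dR^~ w) tR0 (posop_R_infty w) (sR^~ w) (@lR w)).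
Qed.

Lemma SigmaE w : Sigma C R0 w = R0 - R_infty C R0 w.
Proof. exact: tr_limE (tr_cvg_Sigma_partial w). Qed.

Lemma Sigma_bochner E : measurable E -> is_bochner nu E (Sigma C R0)
  (mass E *: R0 - bochner nu E (R_infty C R0)).
Proof.
move=> mE; have [_ _ _ [_]] := R_infty_bochnerP mE.
by have -> : Sigma C R0 = (fun w => R0 - R_infty C R0 w) by apply/funext => w; rewrite SigmaE.
Qed.

Lemma bochner_SigmaE E : measurable E -> bochner nu E (Sigma C R0) =
  mass E *: R0 - bochner nu E (R_infty C R0).
Proof.
move=> mE; apply: bochnerE (Sigma_bochner mE) => // [w|x y x1 y1].
  by rewrite SigmaE; exact: posop_bop.
have -> : (fun w => (ip (Sigma C R0 w x) y)%:E) =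
    (fun w => (ip (R0 x) y)%:E - (ip (R_infty C R0 w x) y)%:E)%E.
  by apply/funext => w; rewrite SigmaE opE ipBl EFinB.
apply: integrableB => //; last exact: R_infty_ip_integrable.
apply: (@finite_valued_integrable _ _ _ nu (fun=> ip (R0 x) y)) => //.
exact: finite_valued_cst.
Qed.

Let DSE n : (fun w : borel_path m => D_ C R0 n.+1 w) = (fun w => Rn n w - Rn n.+1 w).
Proof. by apply/funext => w; exact: D_SE. Qed.

Lemma D_finite_valued n : finite_valued (fun w : borel_path m => D_ C R0 n.+1 w).
Proof. by rewrite DSE; exact: finite_valued_sub. Qed.

Lemma D_bochner n E : measurable E ->
  is_bochner nu E (D_ C R0 n.+1) (simple_integral nu E (Rn n) - simple_integral nu E (Rn n.+1)).
Proof.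
move=> mE; rewrite -simple_integralB// -[D_ C R0 n.+1]/(fun w : borel_path m => D_ C R0 n.+1 w) DSE.
apply: is_bochner_simple => //; apply: finite_valued_simple_op => [|w].
  exact: finite_valued_sub.
apply: (trace_class_le (dR n w) _ (pR 0 w) R0_trace_class).
(* The increment inherits trace class from R0: its difference from R0 is a sum of two positive
   operators. *)
have -> : Rn 0 w - (Rn n w - Rn n.+1 w) = (Rn 0 w - Rn n w) + Rn n.+1 w.
  by rewrite opprB addrCA addrC.
by apply: posop_add => //; exact: (posop_decr (fun n => dR n w) 0%N n).
Qed.

Lemma bochner_DE n E : measurable E -> bochner nu E (D_ C R0 n.+1) =
  simple_integral nu E (Rn n) - simple_integral nu E (Rn n.+1).
Proof.
move=> mE; apply: bochnerE (D_bochner n mE) => // [w|x y x1 y1].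
  by rewrite D_SE//; exact: posop_bop (dR n w).
apply: finite_valued_integrable => //.
exact: (finite_valued_comp (fun v : H -> H => ip (v x) y) (D_finite_valued n)).
Qed.

Lemma M_partialE E N : measurable E ->
  M_partial C R0 nu E N = mass E *: R0 - simple_integral nu E (Rn N).
Proof.
move=> mE; rewrite /M_partial; elim: N => [|N ih].
  rewrite big_geq//; have -> : Rn 0 = (fun=> R0) by apply/funext.
  by rewrite simple_integral_cst // subrr.
by rewrite big_nat_recr//= ih bochner_DE// addrA subrK.
Qed.

Lemma tr_cvg_M_partial E : measurable E ->
  tr_cvg (M_partial C R0 nu E) (mass E *: R0 - bochner nu E (R_infty C R0)).
Proof.
move=> mE; have -> : M_partial C R0 nu E = (fun n => mass E *: R0 - simple_integral nu E (Rn n)).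
  by apply/funext => n; exact: M_partialE.
have [pI cI tI _ _] := R_infty_bochnerP mE.
have pm : posop (mass E *: R0) by apply: posop_scale => //; rewrite fine_ge0.
apply: tr_cvg_subl => // [|n|n].
- apply/trace_classP => //; rewrite optraceZ ?fine_ge0//.
  by rewrite lte_mul_pinfty ?lee_fin ?fine_ge0.
- exact: simple_integral_posop.
- have -> : mass E *: R0 = simple_integral nu E (fun=> R0) by rewrite simple_integral_cst.
  rewrite -simple_integralB//; last exact: finite_valued_cst.
  apply: simple_integral_posop => [|w].
    by apply: finite_valued_sub => //; exact: finite_valued_cst.
  exact: (posop_decr (fun n => dR n w) 0%N n).
Qed.

Lemma M_E E : measurable E ->
  M_ C R0 nu E = mass E *: R0 - bochner nu E (R_infty C R0).
Proof. by move=> mE; exact: tr_limE (tr_cvg_M_partial mE). Qed.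

Lemma posop_M E : measurable E -> posop (M_ C R0 nu E).
Proof. by move=> mE; rewrite M_E//; have [] := R_infty_bochnerP mE. Qed.

(** M(E) differs from nu(E) R0 by the positive integral of [R_infty]. This bound controls both null
    sets and the tails in countable additivity. *)
Lemma optrace_M_le E : measurable E ->
  (optrace (M_ C R0 nu E) <= nu E * optrace R0)%E.
Proof.
move=> mE; have fE : nu E \is a fin_num by rewrite fin_num_measure.
rewrite -(fineK fE) -optraceZ ?fine_ge0// M_E//; apply: le_optrace.
by rewrite subKr; have [] := R_infty_bochnerP mE.
Qed.

Lemma optrace_eq0 (S : H -> H) : posop S -> (optrace S <= 0)%E -> S = 0.
Proof.
move=> pS S0; have e0 : optrace S = 0%E by apply/eqP; rewrite eq_le S0 optrace_ge0.
apply/funext => x; apply: (posop_eq0 pS); apply/eqP; rewrite eq_le posop_ge0// andbT.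
by have := posop_trace_bound x pS; rewrite e0 mul0r; apply.
Qed.

Lemma M_null E : measurable E -> nu E = 0%E -> M_ C R0 nu E = 0.
Proof.
move=> mE E0; apply: optrace_eq0; first exact: posop_M.
by rewrite (le_trans (optrace_M_le mE))// E0 mul0e.
Qed.

Lemma MU (A B : set (borel_path m)) : measurable A -> measurable B ->
  [disjoint A & B] -> M_ C R0 nu (A `|` B) = M_ C R0 nu A + M_ C R0 nu B.
Proof.
move=> mA mB AB; have mAB : measurable (A `|` B) by exact: measurableU.
have -> : M_ C R0 nu A + M_ C R0 nu B =
    mass (A `|` B) *: R0 - (bochner nu A Rinf + bochner nu B Rinf).
  rewrite !M_E// /mass measureU//; last exact/eqP.
  by rewrite fineD ?fin_num_measure// rmorphD /= scalerDl opprD addrACA.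
rewrite M_E//; congr (_ - _).
have [pI _ _ [bI _] _] := R_infty_bochnerP mAB.
have [pA _ _ [bA _] _] := R_infty_bochnerP mA.
have [pB _ _ [bB _] _] := R_infty_bochnerP mB.
have bR w := posop_bop (posop_R_infty w).
apply: op_inj_ball => [||x y x1 y1].
- exact: posop_bop pI.
- exact: bop_add (posop_bop pA) (posop_bop pB).
- have iAB := R_infty_ip_integrable mAB x1 y1.
  apply: EFin_inj; rewrite (is_bochner_weak mAB bI bR x1 y1 iAB).
  rewrite integral_setU//; last by have /integrableP[] := iAB.
  rewrite opE ipDl EFinD; congr (_ + _)%E; apply: esym.
    exact: (is_bochner_weak mA bA bR x1 y1 (R_infty_ip_integrable mA x1 y1)).
  exact: (is_bochner_weak mB bB bR x1 y1 (R_infty_ip_integrable mB x1 y1)).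
Qed.

(** By finite additivity the error after n terms is minus M of the tail V n, a positive operator
    whose trace norm is its trace, at most nu(V n) tr(R0). *)
Lemma M_sigma_additive (F : nat -> set (borel_path m)) :
  (forall k, measurable (F k)) -> trivIset setT F ->
  tr_cvg (fun n => \sum_(0 <= k < n) M_ C R0 nu (F k)) (M_ C R0 nu (\bigcup_k F k)).
Proof.
move=> mF tF; pose U n := \big[setU/set0]_(0 <= k < n) F k.
pose V n := \bigcup_k F k `\` U n.
have mU n : measurable (U n) by exact: bigsetU_measurable.
have mUF : measurable (\bigcup_k F k) by exact: bigcup_measurable.
have mV n : measurable (V n) by exact: measurableD.
have USE n : U n.+1 = U n `|` F n by rewrite /U big_nat_recr.
have UF n : [disjoint U n & F n].
  apply/eqP; rewrite -subset0 => w []; rewrite /U big_mkord -bigcup_mkord.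
  move=> [k /= kn Fk] Fn; have := tF k n I I (ex_intro _ w (conj Fk Fn)).
  by move=> kE; rewrite kE ltnn in kn.
have UVE n : \bigcup_k F k = U n `|` V n.
  rewrite /V setDUK// /U; rewrite big_mkord -bigcup_mkord => w [k _ Fk]; by exists k.
have UV n : [disjoint U n & V n] by apply/eqP; rewrite setDIK.
have SU n : \sum_(0 <= k < n) M_ C R0 nu (F k) = M_ C R0 nu (U n).
  elim: n => [|n ih]; last first.
    rewrite (big_nat_recr _ _ _ (leq0n n)) /= ih (USE n).
    exact: esym (MU (mU n) (mF n) (UF n)).
  rewrite /U !(big_geq (leqnn 0)); exact: esym (M_null measurable0 (measure0 nu)).
have LE n : M_ C R0 nu (\bigcup_k F k) = M_ C R0 nu (U n) + M_ C R0 nu (V n).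
  rewrite [in LHS](UVE n); exact: MU (mU n) (mV n) (UV n).
have nuU n : (\sum_(0 <= k < n) nu (F k))%E = nu (U n).
  elim: n => [|n ih]; first by rewrite /U !big_geq// measure0.
  rewrite (big_nat_recr _ _ _ (leq0n n)) /= ih (USE n).
  exact: esym (measureU nu (mU n) (mF n) (eqP (UF n))).
have nuV : nu (V n) @[n --> \oo] --> 0%E.
  have h : nu (U n) @[n --> \oo] --> nu (\bigcup_k F k).
    have := @measure_semi_sigma_additive _ _ _ nu F mF tF mUF.
    by under eq_fun do rewrite nuU.
  have -> : (fun n => nu (V n)) = (fun n => nu (\bigcup_k F k) - nu (U n))%E.
    apply/funext => n; rewrite (UVE n) (measureU nu (mU n) (mV n) (eqP (UV n))).
    by rewrite addeAC subee ?add0e// fin_num_measure.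
  rewrite -(subee (x := nu (\bigcup_k F k))) ?fin_num_measure//.
  apply: cvgeB => //; last exact: cvg_cst.
  by rewrite fin_num_adde_defr// fin_num_measure.
have tM E : measurable E -> trace_class (M_ C R0 nu E).
  move=> mE; apply/(trace_classP (posop_M mE)).
  rewrite (le_lt_trans (optrace_M_le mE))// -(fineK (x := nu E)) ?fin_num_measure//.
  by rewrite lte_mul_pinfty ?lee_fin ?fine_ge0.
split=> [n||]; [by rewrite SU; exact: tM|exact: tM|].
have -> : (fun n => trnorm (\sum_(0 <= k < n) M_ C R0 nu (F k) -
    M_ C R0 nu (\bigcup_k F k))) = (fun n => optrace (M_ C R0 nu (V n))).
  apply/funext => n; rewrite SU (LE n) opprD addrA subrr add0r.
  by rewrite trnorm_opp ?trnorm_pos//; [exact: posop_M|exact: posop_bop (posop_M _)].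
apply: (@squeeze_cvge _ _ _ _ (cst 0%E) _ (fun n => nu (V n) * optrace R0)%E).
- by apply: nearW => n; rewrite optrace_M_le// optrace_ge0//; exact: posop_M.
- exact: cvg_cst.
- rewrite -(mul0e (optrace R0)); apply: cvgeZr => //.
  by apply: optrace_fin.
Qed.

End Dissipation.

(** * Decay of the trace *)

Section Decay.
Context {R : realType} {H : hilbertType R} {m : nat}.
Variables (C : 'I_m -> H -> H) (R0 : H -> H).
Hypotheses (C_contraction : forall j, contraction_op (C j)) (R0_pos : posop R0).
Hypothesis R0_trace_class : trace_class R0.
Variable nu : probability (borel_path m) R.
Hypothesis nu_trE : is_nu_tr C R0 nu.
Implicit Types (u : seq 'I_m.+1) (w : path_space m).

Lemma R_word_trace_fin v : (optrace (R_word C R0 v) < +oo)%E.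
Proof.
elim/last_ind: v => [|v j ih]; first exact/trace_classP.
apply: le_lt_trans ih; rewrite R_word_rcons; apply: le_optrace.
exact: posop_R_step_diff (posop_R_word C_contraction R0_pos v).
Qed.

Let tr_word v : R := fine (optrace (R_word C R0 v)).
Let tr_path u : R := fine (optrace (R_path C R0 u)).
Let mass u : R := fine (nu (cylinder u)).

Let tr_path_ge0 u : 0 <= tr_path u.
Proof. by rewrite fine_ge0// optrace_ge0//; exact: posop_R_path. Qed.

Lemma e_trE v j : e_tr C R0 v j = tr_word v - tr_word (rcons v j).
Proof.
have pv := posop_R_word C_contraction R0_pos v.
have pj := posop_R_word C_contraction R0_pos (rcons v j).
have pD : posop (R_word C R0 v - R_word C R0 (rcons v j)).
  by rewrite R_word_rcons; exact: posop_R_step_diff.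
rewrite /e_tr /D_word (optraceB pj pD (R_word_trace_fin v)).
by rewrite fineB//; apply: optrace_fin => //; exact: R_word_trace_fin.
Qed.

Lemma mass_rcons u a : mass (rcons u a) = mass u * p_tr C R0 u a.
Proof.
have [_ h] := nu_trE; rewrite /mass h fineM// fin_num_measure//.
exact: measurable_cylinder.
Qed.

Variable alpha : R.
Hypotheses (alpha_gt0 : 0 < alpha) (alpha_le : alpha <= m%:R).
Hypothesis s_ge : forall v, alpha * tr_word v <= s_tr C R0 v.

Let kappa := 1 - alpha / m%:R.

Let m_gt0 : 0 < m%:R :> R. Proof. exact: lt_le_trans alpha_gt0 alpha_le. Qed.

Lemma kappa_ge0 : 0 <= kappa.
Proof. by rewrite subr_ge0 ler_pdivrMr// mul1r. Qed.

Lemma kappa_lt1 : kappa < 1.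
Proof. by rewrite ltrBlDr ltrDl divr_gt0. Qed.

Lemma mean_trace_le u : ord0 \notin u -> 0 < s_tr C R0 (nonzero_prefix u) ->
  \sum_(a < m.+1) p_tr C R0 u a * tr_path (rcons u a) <= kappa * tr_path u.
Proof.
move=> u0 s0; set v := nonzero_prefix u in s0 *; set s := s_tr C R0 v in s0 *.
have pE a : p_tr C R0 u a =
    if unlift ord0 a is Some j then e_tr C R0 v j / s else 0.
  by rewrite /p_tr u0 s0.
rewrite big_ord_recl pE unlift_none mul0r add0r.
have -> : \sum_(j < m) p_tr C R0 u (lift ord0 j) * tr_path (rcons u (lift ord0 j)) =
    tr_word v - s^-1 * \sum_(j < m) e_tr C R0 v j ^+ 2.
  (* With t = tr(R_v), each term is (e_j / s) (t - e_j); the e_j sum to s, which leaves t. *)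
  transitivity (\sum_(j < m) (tr_word v / s * e_tr C R0 v j - s^-1 * e_tr C R0 v j ^+ 2)).
    apply: eq_bigr => j _; rewrite pE liftK /tr_path R_path_rcons_lift// -/v.
    have := e_trE v j; rewrite /tr_word => e; rewrite [X in _ * X](_ : _ = tr_word v - e_tr C R0 v j).
      by rewrite /tr_word; ring.
    by rewrite e subKr.
  by rewrite sumrB -!mulr_sumr -/(s_tr C R0 v) -/s divfK// gt_eqF.
have tu : tr_path u = tr_word v by [].
rewrite tu /kappa mulrBl mul1r lerD2l lerN2.
have cs : s ^+ 2 <= (\sum_(j < m) e_tr C R0 v j ^+ 2) * m%:R.
  have := sum_cauchy_schwarz (index_enum 'I_m) (e_tr C R0 v) (fun=> 1).
  under eq_bigr do rewrite mulr1; under [X in _ <= _ * X]eq_bigr do rewrite expr1n.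
  by rewrite sumr_const card_ord.
(* The chain is alpha t <= s <= m s^-1 (sum of e_j^2). *)
rewrite mulrAC ler_pdivrMr// (le_trans (s_ge v))// -/s.
by rewrite -mulrA ler_pdivlMl// -expr2.
Qed.

(** The first letter 0 has positive probability only where s <= 0, and there [s_ge] forces the trace
    to be 0; later letters leave R unchanged. *)
Lemma mass_tr_path_stop u : ord0 \in u -> mass u * tr_path u = 0.
Proof.
elim/last_ind: u => // u a ih; rewrite mem_rcons inE mass_rcons => ha.
have [u0|u0] := boolP (ord0 \in u).
  by rewrite /tr_path R_path_stop// mulrAC ih// mul0r.
move: ha; rewrite (negbTE u0) orbF => /eqP <-; rewrite /tr_path R_path_rcons0.
have [s0|s0] := ltP 0 (s_tr C R0 (nonzero_prefix u)).
  by rewrite /p_tr u0 s0 /= unlift_none mulr0 mul0r.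
have t0 : tr_word (nonzero_prefix u) = 0.
  apply/eqP; rewrite eq_le fine_ge0 ?andbT; last first.
    by rewrite optrace_ge0//; exact: posop_R_word.
  by rewrite -(pmulr_rle0 _ alpha_gt0) (le_trans (s_ge _)).
by rewrite /R_path -/(tr_word (nonzero_prefix u)) t0 mulr0.
Qed.

Lemma mass_mean_trace_le u :
  \sum_(a < m.+1) mass (rcons u a) * tr_path (rcons u a) <= kappa * (mass u * tr_path u).
Proof.
have [u0|u0] := boolP (ord0 \in u).
  rewrite mass_tr_path_stop// mulr0 big1// => a _.
  by rewrite mass_tr_path_stop// mem_rcons inE u0 orbT.
have m0 : 0 <= mass u by rewrite fine_ge0.
have -> : \sum_(a < m.+1) mass (rcons u a) * tr_path (rcons u a) =
    mass u * \sum_(a < m.+1) p_tr C R0 u a * tr_path (rcons u a).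
  by rewrite mulr_sumr; apply: eq_bigr => a _; rewrite mass_rcons mulrA.
rewrite mulrCA ler_wpM2l//.
have [s0|s0] := ltP 0 (s_tr C R0 (nonzero_prefix u)); first exact: mean_trace_le.
have pE a : p_tr C R0 u a = (a == ord0)%:R by rewrite /p_tr u0 ltNge s0.
have t0 : tr_path u = 0.
  apply/eqP; rewrite eq_le tr_path_ge0 andbT.
  by rewrite -(pmulr_rle0 _ alpha_gt0) (le_trans (s_ge _)).
rewrite t0 mulr0 big1// => a _; rewrite pE.
have [->|_] := eqVneq a ord0; last by rewrite mul0r.
by rewrite /tr_path R_path_rcons0 -/(tr_path u) t0 mulr0.
Qed.

(** The induction on the number of remaining letters runs over all cylinders at once: cutting a
    cylinder into its one-letter extensions takes the place of conditional expectation. *)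
Lemma integral_cylinder_trace_le n u :
  (\int[nu]_(w in cylinder u) (fine (optrace (R_ C R0 (size u + n) w)))%:E <=
   (kappa ^+ n * (mass u * tr_path u))%:E)%E.
Proof.
have mtr k (E : set (borel_path m)) :
    measurable_fun E (fun w : borel_path m => (fine (optrace (R_ C R0 k w)))%:E).
  apply/measurable_EFinP; apply: finite_valued_measurable.
  exact: (finite_valued_comp (fun v : H -> H => fine (optrace v)) (R_finite_valued C R0 k)).
elim: n u => [|n ih] u.
  rewrite addn0 expr0 mul1r (eq_integral (cst (tr_path u)%:E)) => [|w /set_mem].
    rewrite integral_cst; last exact: measurable_cylinder.
    rewrite -[X in (_ * X)%E]fineK; last by rewrite fin_num_measure//; exact: measurable_cylinder.
    by rewrite -EFinM mulrC.
  by rewrite /cylinder /= => uw; rewrite /R_ uw.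
rewrite cylinder_rcons ge0_integral_bigsetU//=; first last.
- by move=> w _; rewrite lee_fin fine_ge0// optrace_ge0//; exact: posop_R_.
- exact: trivIset_cylinder_rcons.
- exact: index_enum_uniq.
- by move=> a; exact: measurable_cylinder.
rewrite exprSr -mulrA.
apply: (@le_trans _ _ (\sum_(a < m.+1)
    (kappa ^+ n * (mass (rcons u a) * tr_path (rcons u a)))%:E)%E).
  apply: lee_sum => a _; have := ih (rcons u a).
  by rewrite size_rcons addSnnS.
rewrite sumEFin lee_fin -mulr_sumr ler_wpM2l ?exprn_ge0 ?kappa_ge0//.
exact: mass_mean_trace_le.
Qed.

Lemma integral_trace_le n :
  (\int[nu]_w (fine (optrace (R_ C R0 n w)))%:E <=
   (kappa ^+ n * fine (optrace R0))%:E)%E.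
Proof.
have := integral_cylinder_trace_le n [::].
have -> : cylinder [::] = [set: borel_path m] by apply/seteqP; split.
rewrite add0n => /le_trans; apply; rewrite lee_fin.
by rewrite /mass; have [-> _] := nu_trE; rewrite mul1r.
Qed.

Lemma integral_trace_infty_eq0 :
  (\int[nu]_w (fine (optrace (R_infty C R0 w)))%:E = 0)%E.
Proof.
have cv := R_infty_integral_trace_cvg C_contraction R0_pos R0_trace_class (nu := nu) measurableT.
have cv0 : (kappa ^+ n * fine (optrace R0))%:E @[n --> \oo] --> 0%E.
  apply: cvg_EFin; first exact: nearW.
  rewrite -(mul0r (fine (optrace R0))); apply: cvgM; last exact: cvg_cst.
  by apply: cvg_expr; rewrite ger0_norm ?kappa_ge0// kappa_lt1.
suff cv1 : (\int[nu]_w (fine (optrace (R_ C R0 n w)))%:E)%E @[n --> \oo] --> 0%E.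
  exact: (cvg_unique _ cv cv1).
apply: (@squeeze_cvge _ _ _ _ (cst 0%E) _ (fun n => (kappa ^+ n * fine (optrace R0))%:E)) => //.
  apply: nearW => n; rewrite integral_trace_le andbT.
  apply: integral_ge0 => w _.
  by rewrite lee_fin fine_ge0// optrace_ge0//; exact: posop_R_.
exact: cvg_cst.
Qed.

End Decay.

Theorem theorem6p2 (R : realType) (H : hilbertType R) (m : nat)
    (m_ge1 : (1 <= m)%N) (C : 'I_m -> H -> H) (R0 : H -> H)
    (C_contraction : forall j, contraction_op (C j)) (R0_pos : posop R0)
    (R0_trace_class : trace_class R0)
    (nu : probability (borel_path m) R) (nu_trE : is_nu_tr C R0 nu) :
  [/\
    (* (1) *)
    {ae nu, forall w,
      [/\ tr_cvg (Sigma_partial C R0 w) (Sigma C R0 w),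
          trace_class_pos (Sigma C R0 w) &
          Sigma C R0 w = R0 - R_infty C R0 w]},
    (* (2) *)
    [/\ forall E, measurable E ->
          [/\ forall n, (1 <= n)%N -> bochner_integrable nu E (D_ C R0 n),
              tr_cvg (M_partial C R0 nu E) (M_ C R0 nu E) &
              trace_class_pos (M_ C R0 nu E)],
        M_ C R0 nu set0 = 0,
        forall F : nat -> set (borel_path m), (forall k, measurable (F k)) ->
          trivIset setT F ->
          tr_cvg (fun n => \sum_(0 <= k < n) M_ C R0 nu (F k))
                 (M_ C R0 nu (\bigcup_k F k)),
        forall E, measurable E -> nu E = 0%E -> M_ C R0 nu E = 0 &
        forall E, measurable E ->
          bochner_integrable nu E (Sigma C R0) /\
          M_ C R0 nu E = bochner nu E (Sigma C R0)],
    (* (3) *)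
    [/\ bochner_integrable nu setT (R_infty C R0),
        M_ C R0 nu setT = R0 - bochner nu setT (R_infty C R0),
        nu.-integrable setT (fun w => optrace (R_infty C R0 w)) &
        optrace (M_ C R0 nu setT) =
          (optrace R0 - \int[nu]_w optrace (R_infty C R0 w))%E] &
    (* (4) *)
    (exists alpha : R, 0 < alpha <= m%:R /\
       forall w : seq 'I_m,
         (alpha%:E * optrace (R_word C R0 w) <= (s_tr C R0 w)%:E)%E) ->
    {ae nu, forall w, Sigma C R0 w = R0} /\
    forall E, measurable E -> M_ C R0 nu E = (fine (nu E))%:C *: R0].
Proof.
have pR := posop_R_infty C_contraction R0_pos.
have tR0 : (optrace R0 < +oo)%E by apply/trace_classP.
have R0R w : posop (R0 - R_infty C R0 w).
  by have [_ _ h] := R_inftyP C_contraction R0_pos w; exact: (h 0).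
have SE := SigmaE C_contraction R0_pos R0_trace_class.
have ME E := M_E C_contraction R0_pos R0_trace_class nu (E := E).
have IP E := R_infty_bochnerP C_contraction R0_pos R0_trace_class nu (E := E).
have trfin w : optrace (R_infty C R0 w) \is a fin_num.
  by apply: optrace_fin => //; exact: le_lt_trans (le_optrace (R0R w)) tR0.
(* The statement uses the extended-valued trace, the integration lemmas its finite part. *)
have trE : (fun w => (fine (optrace (R_infty C R0 w)))%:E) =
    (fun w => optrace (R_infty C R0 w)) by apply/funext => w; rewrite fineK.
have M1 : M_ C R0 nu setT = R0 - bochner nu setT (R_infty C R0).
  by rewrite ME// probability_setT /= scale1r.
split.
- apply: aeW => w; rewrite SE; have tS := tr_cvg_Sigma_partial C_contraction R0_pos R0_trace_class w.
  by split=> //; split=> //; have [] := tS.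
- split.
  + move=> E mE; have tM := tr_cvg_M_partial C_contraction R0_pos R0_trace_class nu mE.
    split=> [[//|n] _||].
    * by exists (simple_integral nu E (R_ C R0 n) - simple_integral nu E (R_ C R0 n.+1));
        exact: D_bochner.
    * by rewrite ME.
    * split; last exact: posop_M.
      by rewrite ME//; have [] := tM.
  + exact: M_null (measure0 nu).
  + by move=> F mF tF; exact: M_sigma_additive.
  + by move=> E mE E0; exact: M_null.
  + move=> E mE; split.
      exists ((fine (nu E))%:C *: R0 - bochner nu E (R_infty C R0)).
      exact: Sigma_bochner.
    rewrite (ME _ mE); apply: esym.
    exact: (bochner_SigmaE C_contraction R0_pos R0_trace_class nu mE).
- have [pI cI _ [bI _] tI] := IP _ measurableT.
  split=> //.
  + by exists (bochner nu setT (R_infty C R0)).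
  + by rewrite -trE; exact: R_infty_trace_integrable.
  + rewrite M1 optraceB//; first by rewrite tI trE.
    by rewrite -M1; exact: posop_M.
- move=> [alpha [/andP[a0 am] sa]].
  have s_ge v : alpha * fine (optrace (R_word C R0 v)) <= s_tr C R0 v.
    rewrite -lee_fin EFinM fineK//; apply: optrace_fin; first exact: posop_R_word.
    exact: R_word_trace_fin.
  have int0 := integral_trace_infty_eq0 C_contraction R0_pos R0_trace_class nu_trE a0 am s_ge.
  have itr := R_infty_trace_integrable C_contraction R0_pos R0_trace_class nu measurableT.
  have tr_ge0 w : (0 <= (fine (optrace (R_infty C R0 w)))%:E)%E.
    by rewrite lee_fin fine_ge0// optrace_ge0.
  split.
    (* A nonnegative function with zero integral vanishes almost everywhere, and a positive operator
       with zero trace is 0. *)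
    have /ae_eq_integral_abs : measurable_fun setT
        (fun w : borel_path m => (fine (optrace (R_infty C R0 w)))%:E) by case/integrableP : itr.
    move=> /(_ nu measurableT)[h _]; have := h _.
    under eq_integral do rewrite gee0_abs//.
    move=> /(_ int0); apply: filterS => w /(_ I) /= w0.
    rewrite SE; suff -> : R_infty C R0 w = 0 by rewrite subr0.
    by apply: optrace_eq0 => //; rewrite -(fineK (trfin w)) w0.
  move=> E mE; have [pI _ _ _ tI] := IP _ mE.
  rewrite (ME _ mE) -[RHS]subr0; congr (_ - _).
  (* The trace of the integral over E is at most the integral of the trace over all paths, which is
     0. *)
  apply: optrace_eq0 => //; rewrite tI -int0.
  apply: (ge0_subset_integral nu mE measurableT) => [|w _|//]; last exact: tr_ge0.
  by case/integrableP : itr.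
Qed.
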